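(* Let $f$ be a holomorphic function in $\mathbb C$ which has real Taylor coefficients $a_k$ in the neighborhood of $z=0$. Then for any odd dimension $n>1$ the equality $$\tau_n[f](x)=\eta_n[f](x)$$ holds for all paravectors $x\in C\ell(n)$ if and only if the recurrence formula $$a_{k+n-1}=\frac{\gamma_n[f]\,k!}{(k+n-1)!}\,a_{k}\qquad (k=0,1,2,\ldots)$$ is satisfied. The constant $\gamma_n[f]$ depends on the dimension $n$ and the function $f$, but not on $k$.
   Context: **Clifford algebra.** $C\ell(n)$ is the real Clifford algebra generated by an orthonormal basis $\mathbf e_1,\dots,\mathbf e_n$ of $\mathbb R^n$ with $\mathbf e_i\mathbf e_j+\mathbf e_j\mathbf e_i=-2\delta_{ij}$. A point $(x_0,\dots,x_n)\in\mathbb R^{n+1}$ is identified with the paravector $x=x_0+\mathbf x$, where $\mathbf x=x_1\mathbf e_1+\dots+x_n\mathbf e_n$; its conjugate is $\overline x=x_0-\mathbf x$. A $C\ell(n)$-valued function on an open subset of $\mathbb R^{n+1}$ is $C\ell(n)$-holomorphic if it is annihilated by the generalized Cauchy-Riemann operator $\partial_{x_0}+\sum_{i=1}^n\mathbf e_i\partial_{x_i}$ (acting from the left). **Appell polynomials.** $P_k^n$ ($k\ge0$) is the $C\ell(n)$-holomorphic polynomial, homogeneous of degree $k$, of the form $$P^n_k(x)=\sum_{s=0}^k {}^nT^k_s\, x^{k-s}\,\overline{x}^{\,s},\qquad P^n_k(1)=1,$$ with real constants ${}^nT^k_s$, whose alternating sums are $$\sum_{s=0}^{k}(-1)^s\,{}^nT_s^k=\begin{cases}\dfrac{(k-1)!!\,(n-2)!!}{(n+k-2)!!},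 & k \text{ even},\\[2mm] \dfrac{k!!\,(n-2)!!}{(n+k-1)!!}, & k\text{ odd},\end{cases}$$ with $(-1)!!=0!!=1$. **Appell extension.** For a function $f$ with real Taylor coefficients $a_k$ at $0$, $\eta_n[f](x)=\sum_{k=0}^\infty a_kP_k^n(x)$ in a neighborhood of the origin $x=0$. **Fueter-Sce transformation.** Let $n>1$ be odd and let $f(w+\mathrm i y)=u(w,y)+\mathrm i v(w,y)$ be holomorphic (for $y\ge 0$), with $u,v$ real valued. Put $\boldsymbol\omega(\mathbf x)=\mathbf x/|\mathbf x|$. Then $$\tau_n[f](x)=\alpha_n[f]\left(\left(\frac1{|\mathbf x|}\partial_{|\mathbf x|}\right)^{\frac{n-1}2}u(x_0,|\mathbf x|)+\boldsymbol\omega(\mathbf x)\left(\partial_{|\mathbf x|}\frac1{|\mathbf x|}\right)^{\frac{n-1}2}v(x_0,|\mathbf x|)\right),$$ where the constant $\alpha_n[f]$ is arbitrary (often used to preserve some property of $f$, such as a normalization at a certain point), and $\partial_{|\mathbf x|}\frac{1}{|\mathbf x|}$ means ''multiply by $1/|\mathbf x|$, then differentiate with respect to $|\mathbf x|$''.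
   Formalization: The constant γ_n[f] is required to be non-zero: with γ_n[f] = 0 the ''if'' part fails, e.g. f = 1 satisfies the recurrence but τ_n[1] = 0 for every α_n[f] while η_n[1] = 1. *)

(* Defs.v *)
From HB Require Import structures.
From mathcomp Require Import all_boot all_order all_algebra.
From mathcomp Require Import all_classical all_reals all_analysis.
From mathcomp Require Import complex.
Set Implicit Arguments.
Unset Strict Implicit.
Unset Printing Implicit Defensive.
Import Order.TTheory GRing.Theory Num.Theory.
Import numFieldNormedType.Exports.
Local Open Scope classical_set_scope.
Local Open Scope ring_scope.
Local Open Scope complex_scope.

(* An element of Cl(n) is the row of its coordinates in the basis (e_A), where
   e_A = e_{i1} ... e_{ip} for A = {i1 < ... < ip} included in {0, ..., n-1}.
   The generators e_1, ..., e_n are thus indexed by 0, ..., n-1. *)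
Definition clifford (R : realType) (n : nat) := 'rV[R]_#|{set 'I_n}|.

HB.instance Definition _ (R : realType) (n : nat) :=
  NormedModule.copy (clifford R n) 'rV[R]_#|{set 'I_n}|.

Section CliffordAlgebra.
Variables (R : realType) (n : nat).
Local Notation Cl := (clifford R n).
Implicit Types (A B C : {set 'I_n}) (x y z : Cl).

Definition cl_coord x A : R := x 0 (enum_rank A).

Definition cl_mk (c : {set 'I_n} -> R) : Cl := \row_k c (enum_val k).

Definition cl_basis A : Cl := cl_mk (fun B => (B == A)%:R).

Definition cl_e (i : 'I_n) : Cl := cl_basis [set i]%SET.

Definition cl_symdiff A B : {set 'I_n} := (A :\: B) :|: (B :\: A).

(* e_A e_B = (-1) ^ (cl_swaps A B) e_(A symdiff B): moving the factors of e_B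
   into place costs a sign for each pair i > j (anticommutation), and e_i e_i
   is -1 for each i = j. *)
Definition cl_swaps A B : nat := \sum_(i in A) \sum_(j in B) (j <= i)%N.

Definition cl_mul x y : Cl :=
  \sum_(A : {set 'I_n}) \sum_(B : {set 'I_n})
    ((-1) ^+ cl_swaps A B * (cl_coord x A * cl_coord y B))
      *: cl_basis (cl_symdiff A B).

Lemma cl_mkK c A : cl_coord (cl_mk c) A = c A.
Proof. by rewrite /cl_coord mxE enum_rankK. Qed.

Lemma cl_coordP x y : (forall A, cl_coord x A = cl_coord y A) -> x = y.
Proof.
move=> exy; apply/rowP => k; have := exy (enum_val k).
by rewrite /cl_coord enum_valK.
Qed.

Lemma cl_coord_sum I (r : seq I) (P : pred I) (F : I -> Cl) A :
  cl_coord (\sum_(i <- r | P i) F i) A = \sum_(i <- r | P i) cl_coord (F i) A.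
Proof. exact: summxE. Qed.

Lemma cl_coordZ a x A : cl_coord (a *: x) A = a * cl_coord x A.
Proof. exact: mxE. Qed.

Lemma cl_coordD x y A : cl_coord (x + y) A = cl_coord x A + cl_coord y A.
Proof. exact: mxE. Qed.

Lemma cl_coord_basis A B : cl_coord (cl_basis A) B = (B == A)%:R.
Proof. by rewrite cl_mkK. Qed.

Lemma cl_basis_sum x : x = \sum_A cl_coord x A *: cl_basis A.
Proof.
apply: cl_coordP => B; rewrite cl_coord_sum (bigD1 B)//= cl_coordZ.
rewrite cl_coord_basis eqxx mulr1 big1 ?addr0// => A neAB.
by rewrite cl_coordZ cl_coord_basis eq_sym (negPf neAB) mulr0.
Qed.

Lemma cl_mul_linl y : linear (fun x => cl_mul x y).
Proof.
move=> a x x'; rewrite /cl_mul scaler_sumr -big_split/=.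
apply: eq_bigr => A _; rewrite scaler_sumr -big_split/=; apply: eq_bigr => B _.
rewrite scalerA -scalerDl cl_coordD cl_coordZ; congr (_ *: _).
by rewrite mulrDl mulrDr -mulrA [in RHS]mulrCA.
Qed.

Lemma cl_mul_linr x : linear (cl_mul x).
Proof.
move=> a y y'; rewrite /cl_mul scaler_sumr -big_split/=.
apply: eq_bigr => A _; rewrite scaler_sumr -big_split/=; apply: eq_bigr => B _.
rewrite scalerA -scalerDl cl_coordD cl_coordZ; congr (_ *: _).
by rewrite mulrDr mulrDr [cl_coord x A * _]mulrCA [in RHS]mulrCA.
Qed.

Lemma cl_mulDl : left_distributive cl_mul +%R.
Proof. by move=> x x' y; have := cl_mul_linl y 1 x x'; rewrite !scale1r. Qed.

Lemma cl_mulDr : right_distributive cl_mul +%R.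
Proof. by move=> x y y'; have := cl_mul_linr x 1 y y'; rewrite !scale1r. Qed.

Lemma cl_mul0l x : cl_mul 0 x = 0.
Proof. by apply: (addIr (cl_mul 0 x)); rewrite -cl_mulDl !add0r. Qed.

Lemma cl_mul0r x : cl_mul x 0 = 0.
Proof. by apply: (addIr (cl_mul x 0)); rewrite -cl_mulDr !add0r. Qed.

Lemma cl_mulZl a x y : cl_mul (a *: x) y = a *: cl_mul x y.
Proof. by have := cl_mul_linl y a x 0; rewrite !addr0 cl_mul0l addr0. Qed.

Lemma cl_mulZr a x y : cl_mul x (a *: y) = a *: cl_mul x y.
Proof. by have := cl_mul_linr x a y 0; rewrite !addr0 cl_mul0r addr0. Qed.

Lemma cl_ind (P : Cl -> Prop) : P 0 ->
  (forall a x y, P x -> P y -> P (a *: x + y)) -> (forall A, P (cl_basis A)) ->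
  forall x, P x.
Proof.
move=> P0 PD PB x; rewrite (cl_basis_sum x).
by elim/big_rec: _ => // A y _; exact: PD.
Qed.

Lemma cl_mul_basis A B : cl_mul (cl_basis A) (cl_basis B) =
  (-1) ^+ cl_swaps A B *: cl_basis (cl_symdiff A B).
Proof.
rewrite /cl_mul (bigD1 A)//= (bigD1 B)//= !cl_coord_basis !eqxx !mulr1.
rewrite big1 ?addr0 => [|B' neB]; last first.
  by rewrite !cl_coord_basis (negPf neB) !mulr0 scale0r.
rewrite big1 ?addr0// => A' neA; apply: big1 => B' _.
by rewrite !cl_coord_basis (negPf neA) mul0r mulr0 scale0r.
Qed.

Lemma cl_in_symdiff A B i : (i \in cl_symdiff A B) = (i \in A) (+) (i \in B).
Proof. by rewrite !inE; case: (i \in A); case: (i \in B). Qed.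

Lemma cl_symdiffA A B C :
  cl_symdiff A (cl_symdiff B C) = cl_symdiff (cl_symdiff A B) C.
Proof. by apply/setP => i; rewrite !cl_in_symdiff addbA. Qed.

Lemma cl_odd_sum I (r : seq I) (P : pred I) (F : I -> nat) :
  odd (\sum_(i <- r | P i) F i) = \big[addb/false]_(i <- r | P i) odd (F i).
Proof. by elim/big_rec2: _ => // i u v _ <-; rewrite oddD. Qed.

Lemma cl_odd_symdiff A B (F : 'I_n -> nat) :
  odd (\sum_(i in cl_symdiff A B) F i) =
  odd (\sum_(i in A) F i) (+) odd (\sum_(i in B) F i).
Proof.
rewrite !cl_odd_sum big_mkcond [in RHS]big_mkcond/= [X in _ = _ (+) X]big_mkcond/=.
rewrite -big_split/=; apply: eq_bigr => i _; rewrite cl_in_symdiff.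
by case: (i \in A); case: (i \in B) => //=; rewrite ?addbb ?addbF.
Qed.

Lemma cl_swapsDl A B C :
  odd (cl_swaps (cl_symdiff A B) C) = odd (cl_swaps A C) (+) odd (cl_swaps B C).
Proof. exact: cl_odd_symdiff. Qed.

Lemma cl_swapsDr A B C :
  odd (cl_swaps A (cl_symdiff B C)) = odd (cl_swaps A B) (+) odd (cl_swaps A C).
Proof.
rewrite /cl_swaps exchange_big cl_odd_symdiff.
by congr (odd _ (+) odd _); rewrite exchange_big.
Qed.

Lemma cl_mulA : associative cl_mul.
Proof.
move=> x y z; elim/cl_ind: x => [|a x x' IH IH'|A].
- by rewrite !cl_mul0l.
- by rewrite !cl_mulDl !cl_mulZl IH IH'.
elim/cl_ind: y => [|a y y' IH IH'|B].
- by rewrite cl_mul0l !cl_mul0r cl_mul0l.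
- by rewrite cl_mulDl cl_mulZl !cl_mulDr !cl_mulZr cl_mulDl cl_mulZl IH IH'.
elim/cl_ind: z => [|a z z' IH IH'|C].
- by rewrite !cl_mul0r.
- by rewrite !cl_mulDr !cl_mulZr IH IH'.
rewrite !cl_mul_basis cl_mulZl cl_mulZr !cl_mul_basis !scalerA cl_symdiffA.
rewrite -!exprD; congr (_ *: _); rewrite -[LHS]signr_odd -[RHS]signr_odd.
rewrite !oddD cl_swapsDl cl_swapsDr.
by do 3 case: (odd _).
Qed.

Lemma cl_symdiff0 A : cl_symdiff finset.set0 A = A.
Proof. by apply/setP => i; rewrite cl_in_symdiff inE. Qed.

Lemma cl_symdiffr0 A : cl_symdiff A finset.set0 = A.
Proof. by apply/setP => i; rewrite cl_in_symdiff inE addbF. Qed.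

Lemma cl_mul1l : left_id (cl_basis finset.set0) cl_mul.
Proof.
elim/cl_ind => [|a x y IHx IHy|A]; first by rewrite cl_mul0r.
  by rewrite cl_mulDr cl_mulZr IHx IHy.
by rewrite cl_mul_basis cl_symdiff0 /cl_swaps big_set0 expr0 scale1r.
Qed.

Lemma cl_mul1r : right_id (cl_basis finset.set0) cl_mul.
Proof.
elim/cl_ind => [|a x y IHx IHy|A]; first by rewrite cl_mul0l.
  by rewrite cl_mulDl cl_mulZl IHx IHy.
rewrite cl_mul_basis cl_symdiffr0 /cl_swaps big1 ?expr0 ?scale1r// => i _.
by rewrite big_set0.
Qed.

Lemma cl_oner_neq0 : cl_basis finset.set0 != 0.
Proof.
apply/eqP => /(congr1 (cl_coord^~ finset.set0)); rewrite cl_coord_basis eqxx /cl_coord.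
by rewrite mxE => /eqP; rewrite oner_eq0.
Qed.

HB.instance Definition _ := GRing.Zmodule_isNzRing.Build Cl
  cl_mulA cl_mul1l cl_mul1r cl_mulDl cl_mulDr cl_oner_neq0.

HB.instance Definition _ := GRing.Lmodule_isLalgebra.Build R Cl
  (fun a x y => esym (cl_mulZl a x y)).

HB.instance Definition _ := GRing.Lalgebra_isAlgebra.Build R Cl
  (fun a x y => esym (cl_mulZr a x y)).

Lemma cl_e_anticomm (i j : 'I_n) :
  cl_e i * cl_e j + cl_e j * cl_e i = - (2 * (i == j)%:R)%:A.
Proof.
have mulE k l : cl_e k * cl_e l =
    (-1) ^+ (l <= k)%N *: cl_basis (cl_symdiff [set k]%SET [set l]%SET).
  by rewrite [LHS]cl_mul_basis /cl_swaps !big_set1.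
have symC : cl_symdiff [set j]%SET [set i]%SET = cl_symdiff [set i]%SET [set j]%SET.
  by rewrite /cl_symdiff finset.setUC.
rewrite !mulE symC -scalerDl; case: (eqVneq i j) => [->|neij].
  rewrite leqnn !expr1 mulr1 -opprD scaleNr; congr (- (_ *: _)).
  congr cl_basis; apply/setP => k.
  by rewrite cl_in_symdiff finset.in_set0 addbb.
rewrite mulr0 scale0r oppr0; have := neij; rewrite -val_eqE neq_ltn.
by case/orP => lt; rewrite (ltnW lt) leqNgt lt/= expr0 expr1 ?subrr ?addNr scale0r.
Qed.

End CliffordAlgebra.

Section Paravectors.
Variables (R : realType) (n : nat).
Local Notation Cl := (clifford R n).
(* The point (x_0, x_1, ..., x_n): x 0 ord0 is x_0 and x 0 (lift ord0 i) is the
   coordinate along the generator cl_e i. *)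
Implicit Types x : 'rV[R]_n.+1.

Definition pvec x : Cl := \sum_(i < n) x 0 (lift ord0 i) *: cl_e R i.

Definition para x : Cl := (x 0 ord0)%:A + pvec x.

Definition para_conj x : Cl := (x 0 ord0)%:A - pvec x.

(* Euclidean; the library norm on 'rV[R]_n.+1 is the sup norm. *)
Definition pvec_norm x : R := Num.sqrt (\sum_(i < n) x 0 (lift ord0 i) ^+ 2).

Definition pvec_dir x : Cl := (pvec_norm x)^-1 *: pvec x.

Definition cauchy_riemann (F : 'rV[R]_n.+1 -> Cl) x : Cl :=
  'D_(delta_mx 0 ord0) F x +
  \sum_(i < n) cl_e R i * 'D_(delta_mx 0 (lift ord0 i)) F x.

Definition cl_holomorphic (U : set 'rV[R]_n.+1) (F : 'rV[R]_n.+1 -> Cl) :=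
  open U /\ forall x, U x -> differentiable F x /\ cauchy_riemann F x = 0.

End Paravectors.

Fixpoint dfact (m : nat) : nat := if m is p.+2 then (m * dfact p)%N else 1.

Section Appell.
Variables (R : realType) (n : nat) (T : nat -> nat -> R).

Definition appell_poly (k : nat) (x : 'rV[R]_n.+1) : clifford R n :=
  \sum_(s < k.+1) T k s *: (para x ^+ (k - s) * para_conj x ^+ s).

(* For k = 0 the truncated k.-1 is harmless, as (-1)!! = 0!! = 1. *)
Definition appell_alt_sum (k : nat) : R :=
  if odd k then (dfact k * dfact (n - 2))%:R / (dfact (n + k - 1))%:R
  else (dfact k.-1 * dfact (n - 2))%:R / (dfact (n + k - 2))%:R.

(* The point (1, 0, ..., 0) is delta_mx 0 ord0. *)
Definition appell_coefs := forall k,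
  [/\ cl_holomorphic setT (appell_poly k),
      appell_poly k (delta_mx 0 ord0) = 1 &
      \sum_(s < k.+1) (-1) ^+ s * T k s = appell_alt_sum k].

Definition appell_ext_sums (a : nat -> R) (x : 'rV[R]_n.+1) :
  (clifford R n)^nat := series (fun k => a k *: appell_poly k x).

End Appell.

(* R[i]^o is R[i] as a normed space over R[i], so that derivable is complex
   differentiability. *)
Definition entire (R : realType) (f : R[i] -> R[i]) :=
  forall z : R[i]^o, derivable (f : R[i]^o -> R[i]^o) z 1.

Definition taylor_at0 (R : realType) (f : R[i] -> R[i]) (a : nat -> R) :=
  \forall z \near (0 : R[i]^o),
    (series (fun k => (a k)%:C * z ^+ k) : (R[i]^o)^nat) @ \oo --> (f z : R[i]^o).

Section FueterSce.
Variables (R : realType) (n : nat) (f : R[i] -> R[i]) (alpha : R).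

Definition re_part (w y : R) : R := complex.Re (f (w +i* y)).
Definition im_part (w y : R) : R := complex.Im (f (w +i* y)).

Definition fueter_sce_off_axis (x : 'rV[R]_n.+1) : clifford R n :=
  let m := (n.-1)./2 in
  let x0 := x 0 ord0 in
  let r := pvec_norm x in
  alpha *:
    ((iter m (fun (g : R -> R) t => t^-1 * derive1 g t) (re_part x0) r)%:A +
     iter m (fun (g : R -> R) => derive1 (fun t => t^-1 * g t)) (im_part x0) r
       *: pvec_dir x).

(* The formula is singular on the real axis, where it is extended by
   continuity. *)
Definition fueter_sce (x : 'rV[R]_n.+1) : clifford R n :=
  if pvec x == 0
  then lim (fueter_sce_off_axis @ within [set y | pvec y != 0] (nbhs x))
  else fueter_sce_off_axis x.

End FueterSce.

(* Main.v *)
(* The two transformations are compared through entire power series.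

   Appell side.  Expanding in powers of x_0 and of the vector X (with X^2 = -|X|^2),
   the Cauchy-Riemann equation becomes a two-term recurrence on coefficients, hence
   P_k = sum_j binom(k, j) c_j x_0^(k-j) X^j, where c_j = j! / (beta_1 ... beta_j),
   beta_j = j for j even and beta_j = j + n - 1 for j odd.

   Fueter-Sce side.  On the Taylor series of u(x_0, .) and v(x_0, .) the operators
   (1/t) d/dt and d/dt (1/t) shift the index by 2 and multiply by integers.  After
   m = (n-1)/2 steps these integers match the c_j up to one constant kappa, so that
   tau_n[f] = alpha kappa eta_n[f^(n-1)] for every entire f with real coefficients.
   Restricting to the real axis, tau_n[f] = eta_n[f] means f = alpha kappa f^(n-1).

   Both conditions of the theorem force the a_k to be the coefficients of an
   everywhere convergent series, which coincides with f near 0.  That it coincides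
   with f everywhere is the identity theorem, for functions which are only assumed
   complex differentiable: by Goursat's argument h has a primitive F, hence F is
   twice differentiable; if F vanishes near 0 then F / z^N is too, and the
   elementary maximum principle on a square of half-side L gives
   |F(z)| <= M (|z| / L)^N for all N. *)
Require Import Defs.
From mathcomp Require Import all_boot all_order all_algebra.
From mathcomp Require Import all_classical all_reals all_analysis.
From mathcomp Require Import complex ring lra.
Set Implicit Arguments.
Unset Strict Implicit.
Unset Printing Implicit Defensive.
Import Order.TTheory GRing.Theory Num.Theory.
Import numFieldNormedType.Exports.
Import Normc.
Local Open Scope classical_set_scope.
Local Open Scope ring_scope.
Local Open Scope complex_scope.

(** * Closed forms in the plane *)

Section Goursat.
Variable R : realType.
Implicit Types (g G : R -> R) (p q : R -> R -> R).

(** Each side is a sum over $k$ that has to be reordered by powers of $t=|\mathbf x|$. Since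
    $|c_j|\le 1$, and the real and imaginary parts of $\mathrm i^j$ are also at most 1 in absolute
    value, one rearrangement statement with arbitrary weights bounded by 1 serves both $f$ on a
    vertical line and the Appell series. Parity in $t$ is the second theme. The scalar part has only
    even powers and the vector part only odd ones; this makes every division by $t$ in the iterated
    operators a mere shift of coefficients, and it makes the vector part tend to 0 at the real axis,
    where the direction $\boldsymbol\omega$ itself has no limit. Constants: with $n=2m+1$,
    $\kappa=(-1)^m/(n-2)!!$, the sign coming from $\mathrm i^{2m}$. The two constants of the theorem
    are tied by $\gamma=1/(\alpha\kappa)$, except when $\alpha=0$: then all $a_k$ vanish and any
    nonzero $\gamma$ will do. *)

Lemma is_derive_epsP g (x D : R) : is_derive x 1 g D <->
  (forall e, 0 < e -> exists2 d, 0 < d &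
    forall h, `|h| < d -> `|g (x + h) - g x - D * h| <= e * `|h|).
Proof.
split=> [gD e e0|H].
- have /cvgrPdist_le /(_ e e0) : h^-1 *: (g (h *: 1 + x) - g x) @[h --> 0^'] --> D.
    by case: gD => dg <-; exact: dg.
  case=> d /= d0 Hd; exists d => // h hd.
  have [->|h0] := eqVneq h 0; first by rewrite addr0 mulr0 subrr subr0 normr0 mulr0.
  have := Hd h; rewrite /= sub0r normrN => /(_ hd h0).
  rewrite -(ler_pM2r (_ : 0 < `|h|)) ?normr_gt0// -normrM mulrBl distrC.
  by rewrite [h *: 1]mulr1 -[h^-1 *: _]/(h^-1 * _) mulrAC mulVf// mul1r (addrC h).
- have lim : h^-1 *: (g (h *: 1 + x) - g x) @[h --> 0^'] --> D.
    apply/cvgrPdist_le => e e0; have [d d0 Hd] := H e e0.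
    exists d => //= h /=; rewrite sub0r normrN => hd h0.
    rewrite -(ler_pM2r (_ : 0 < `|h|)) ?normr_gt0// -normrM mulrBl distrC.
    rewrite [h *: 1]mulr1 -[h^-1 *: _]/(h^-1 * _) mulrAC mulVf// mul1r (addrC h).
    exact: Hd.
  by apply: DeriveDef; [apply/cvg_ex; exists D|apply/cvg_lim].
Qed.

Lemma mean_value_le G g (a b M : R) : a <= b ->
  (forall x : R, a <= x <= b -> is_derive x 1 G (g x)) ->
  (forall x : R, a <= x <= b -> `|g x| <= M) -> `|G b - G a| <= M * (b - a).
Proof.
move=> ab dG gM.
have [||c] := @MVT_segment R G g a b ab.
- by move=> x; rewrite in_itv/= => /andP[ax xb]; apply: dG; rewrite !ltW.
- apply: derivable_within_continuous => x; rewrite in_itv/= => /dG.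
  by case.
rewrite in_itv/= => /gM cM ->; rewrite normrM (@ger0_norm _ (b - a)) ?subr_ge0//.
by rewrite ler_wpM2r// subr_ge0.
Qed.

Lemma mean_value_le_sym G g (x y M : R) :
  (forall z : R, `|z - x| <= `|y - x| -> is_derive z 1 G (g z)) ->
  (forall z : R, `|z - x| <= `|y - x| -> `|g z| <= M) ->
  `|G y - G x| <= M * `|y - x|.
Proof.
move=> dG gM; have [xy|/ltW yx] := leP x y.
  rewrite (@ger0_norm _ (y - x)) ?subr_ge0//; apply: (@mean_value_le _ g) => //.
  - move=> z /andP[xz zy]; apply: dG.
    by rewrite !ger0_norm ?subr_ge0// lerD2r.
  - move=> z /andP[xz zy]; apply: gM.
    by rewrite !ger0_norm ?subr_ge0// lerD2r.
rewrite distrC (@distrC _ _ y x) (@ger0_norm _ (x - y)) ?subr_ge0//.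
apply: (@mean_value_le _ g) => //.
- move=> z /andP[yz zx]; apply: dG.
  by rewrite distrC (distrC y) !ger0_norm ?subr_ge0// lerD2l lerN2.
- move=> z /andP[yz zx]; apply: gM.
  by rewrite distrC (distrC y) !ger0_norm ?subr_ge0// lerD2l lerN2.
Qed.

Lemma antiderivative_right g (a : R) : continuous g ->
  exists G : R -> R, forall x : R, a < x -> is_derive x 1 G (g x).
Proof.
move=> cg; pose G y := \int[lebesgue_measure]_(t in `[a, y]) g t.
exists G => x ax.
have [||dG <-] := @continuous_FTC1_closed R g a x (x + 1) _ _ ax (cg x).
- by rewrite ltrDl.
- apply: continuous_compact_integrable; first exact: segment_compact.
  exact: continuous_subspaceT.
- by rewrite derive1E; exact: DeriveDef.
Qed.

(** An integral with fixed base point is a primitive only to the right of that point. Reflecting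
    $x\mapsto -x$ gives a primitive on the left; on the overlap $(-1,1)$ the two differ by a
    constant, which is corrected when they are glued at 0. *)
Lemma antiderivative g : continuous g ->
  exists G : R -> R, forall x : R, is_derive x 1 G (g x).
Proof.
move=> cg; have [G1 dG1] := @antiderivative_right g (-1) cg.
have cg' : continuous (fun x => - g (- x)).
  move=> x; apply: (@continuousN _ _ _ (g \o -%R)).
  by apply: continuous_comp; [exact: opp_continuous|exact: cg].
have [G2' dG2'] := @antiderivative_right _ (-1) cg'.
pose G2 := G2' \o -%R.
have dG2 (x : R) : x < 1 -> is_derive x 1 G2 (g x).
  move=> x1; have := dG2' (- x); rewrite ltrN2 opprK => /(_ x1) dG.
  have := @is_derive1_comp R G2' -%R x.
  move=> /(_ (- g x) (-1) dG); rewrite mulrN1 opprK; exact.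
have E (x : R) : -1 < x < 1 -> G1 x - G2 x = G1 0 - G2 0.
  move=> /andP[x1 x2].
  have := @mean_value_le_sym (G1 - G2) (fun z => g z - g z) 0 x 0.
  rewrite mul0r subr0.
  have zin (z : R) : `|z - 0| <= `|x| -> -1 < z < 1.
    by rewrite subr0 -ltr_norml => /le_lt_trans; apply; rewrite ltr_norml x1.
  move=> H; apply/eqP; rewrite -subr_eq0 -normr_le0; apply: H => z /zin /andP[z1 z2].
  - by apply: is_deriveB; [exact: dG1|exact: dG2].
  - by rewrite subrr normr0.
exists (fun x => if 0 < x then G1 x else G2 x + (G1 0 - G2 0)) => x.
have [x0|x0] := ltP (- 1) x.
  have [x1|x1] := ltP x 1; last first.
    have x0' : 0 < x by rewrite (lt_le_trans _ x1).
    apply: near_eq_is_derive (dG1 x x0).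
    near=> z; rewrite ifT//; near: z; exact: lt_nbhsr.
  apply: near_eq_is_derive (dG1 x x0).
  near=> z; case: ifPn => // _; rewrite -(E z); first by rewrite addrCA subrr addr0.
  apply/andP; split; near: z; [exact: lt_nbhsr|exact: lt_nbhsl].
have xlt0 : x < 0 by rewrite (le_lt_trans x0)// ltrN10.
have : is_derive x 1 (G2 + cst (G1 0 - G2 0)) (g x + 0).
  by apply: is_deriveD; apply: dG2; rewrite (lt_trans xlt0).
rewrite addr0; apply: near_eq_is_derive.
near=> z; rewrite ifF//; apply/negbTE; rewrite -leNgt ltW//; near: z.
exact: lt_nbhsl.
Unshelve. all: by end_near. Qed.

(** Fréchet differentiability at $(x,y)$ with gradient $(A,B)$, the error being measured against the
    $\ell^1$ norm of the increment. *)
Definition tdiff p (x y A B : R) := forall e, 0 < e -> exists2 d, 0 < d &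
  forall s t : R, `|s| < d -> `|t| < d ->
    `|p (x + s) (y + t) - p x y - A * s - B * t| <= e * (`|s| + `|t|).


(** The mean value inequality for $G$ minus the quadratic primitive of $k_0+k_1(x-c)$: the integral
    of the affine part is kept exactly, and only the error is estimated. *)
Lemma mean_value_affine G g (a b c M k0 k1 : R) : a <= b ->
  (forall x : R, is_derive x 1 G (g x)) ->
  (forall x : R, a <= x <= b -> `|g x - k0 - k1 * (x - c)| <= M) ->
  `|G b - G a - (k0 * (b - a) + k1 * ((b - c) ^+ 2 - (a - c) ^+ 2) / 2)|
    <= M * (b - a).
Proof.
move=> ab dG gM.
pose H (x : R) := G x - (k0 * x + k1 / 2 * (x - c) ^+ 2).
rewrite [X in `|X|](_ : _ = H b - H a); last by rewrite /H; field.
apply: (@mean_value_le _ (fun x => g x - k0 - k1 * (x - c))) => // x _.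
have d2 : is_derive x 1 (fun x : R => x - c) 1.
  by rewrite -[X in is_derive _ _ _ X]subr0; exact: is_deriveB.
have d1 := @is_deriveZ _ _ _ id k0 x 1 1 (is_derive_id _ _).
have d4 := @is_deriveZ _ _ _ _ (k1 / 2) _ _ _ (@is_deriveX _ _ _ 2 x 1 1 d2).
apply: (is_derive_eq (is_deriveB (dG x) (is_deriveD d1 d4))).
by rewrite /GRing.scale /=; field.
Qed.

Section Primitive.
Variables p q P Q : R -> R -> R.
Hypothesis dP : forall x y : R, is_derive x 1 (P^~ y) (p x y).
Hypothesis dQ : forall x y : R, is_derive y 1 (Q x) (q x y).

(* The integral of p dx + q dy around a rectangle, written with antiderivatives P of p
   along horizontal lines and Q of q along vertical lines. *)
Definition circulation (a b c d : R) :=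
  (P b c - P a c) - (P b d - P a d) + (Q b d - Q b c) - (Q a d - Q a c).

(** The linearized form is closed, because the same $B$ is the $y$-slope of $p$ and the $x$-slope of
    $q$; its circulation is therefore zero. What remains is one error term per side, at most $e$
    times the length of the side. *)
Lemma circulation_local (x0 y0 A B C e a b c d : R) :
  a <= b -> c <= d ->
  (forall x y, a <= x <= b -> c <= y <= d ->
     `|p x y - p x0 y0 - A * (x - x0) - B * (y - y0)| <= e) ->
  (forall x y, a <= x <= b -> c <= y <= d ->
     `|q x y - q x0 y0 - B * (x - x0) - C * (y - y0)| <= e) ->
  `|circulation a b c d| <= 2 * e * (b - a + (d - c)).
Proof.
move=> ab cd Hp Hq.
have hP y : c <= y <= d -> `|P b y - P a y - ((p x0 y0 + B * (y - y0)) * (b - a)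
    + A * ((b - x0) ^+ 2 - (a - x0) ^+ 2) / 2)| <= e * (b - a).
  move=> ycd; apply: (@mean_value_affine _ (p^~ y)) => // x xab.
  rewrite (_ : _ - _ - _ = p x y - p x0 y0 - A * (x - x0) - B * (y - y0)); last by ring.
  exact: Hp.
have hQ x : a <= x <= b -> `|Q x d - Q x c - ((q x0 y0 + B * (x - x0)) * (d - c)
    + C * ((d - y0) ^+ 2 - (c - y0) ^+ 2) / 2)| <= e * (d - c).
  move=> xab; apply: (@mean_value_affine _ (q x)) => // y ycd.
  rewrite (_ : _ - _ - _ = q x y - q x0 y0 - B * (x - x0) - C * (y - y0)); last by ring.
  exact: Hq.
have := hP c; have := hP d; rewrite !lexx cd => /(_ isT) h1 /(_ isT) h2.
have := hQ a; have := hQ b; rewrite !lexx ab => /(_ isT) h3 /(_ isT) h4.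
move: h1 h2 h3 h4.
set u1 := P b d - P a d - _; set u2 := P b c - P a c - _.
set u3 := Q b d - Q b c - _; set u4 := Q a d - Q a c - _ => h1 h2 h3 h4.
rewrite (_ : circulation a b c d = u2 - u1 + u3 - u4); last first.
  by rewrite /circulation /u1 /u2 /u3 /u4; field.
rewrite (le_trans (ler_normB _ _))// (le_trans (lerD (ler_normD _ _) (lexx _)))//.
rewrite (le_trans (lerD (lerD (ler_normB _ _) (lexx _)) (lexx _)))//.
by apply: le_trans (lerD (lerD (lerD h2 h1) h3) h4) _; lra.
Qed.

Lemma circulation_split (a b c d m k : R) :
  circulation a b c d = circulation a m c k + circulation m b c k +
    circulation a m k d + circulation m b k d.
Proof. by rewrite /circulation; ring. Qed.

Lemma circulation_quarter (a b c d m k : R) :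
  [\/ `|circulation a b c d| <= 4 * `|circulation a m c k|,
      `|circulation a b c d| <= 4 * `|circulation m b c k|,
      `|circulation a b c d| <= 4 * `|circulation a m k d| |
      `|circulation a b c d| <= 4 * `|circulation m b k d| ].
Proof.
have := circulation_split a b c d m k.
move: (circulation a m c k) (circulation m b c k) (circulation a m k d) (circulation m b k d).
move=> c1 c2 c3 c4 ->.
have H : `|c1 + c2 + c3 + c4| <= `|c1| + `|c2| + `|c3| + `|c4|.
  rewrite (le_trans (ler_normD _ _))// lerD2r (le_trans (ler_normD _ _))// lerD2r.
  exact: ler_normD.
have [?|h1] := leP `|c1 + c2 + c3 + c4| (4 * `|c1|); first by constructor 1.
have [?|h2] := leP `|c1 + c2 + c3 + c4| (4 * `|c2|); first by constructor 2.
have [?|h3] := leP `|c1 + c2 + c3 + c4| (4 * `|c3|); first by constructor 3.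
have [?|h4] := leP `|c1 + c2 + c3 + c4| (4 * `|c4|); first by constructor 4.
lra.
Qed.

Hypothesis closed_form : forall x y, exists A B C,
  tdiff p x y A B /\ tdiff q x y B C.

(* Goursat: some quarter keeps at least a fourth of the circulation, which is
   quadratically small near a point of differentiability. *)
Lemma circulation0_le (a b c d : R) : a <= b -> c <= d -> circulation a b c d = 0.
Proof.
move=> ab cd; pose w n := (b - a) / 2 ^+ n; pose h n := (d - c) / 2 ^+ n.
have w0 n : 0 <= w n by rewrite mulr_ge0 ?subr_ge0// invr_ge0 exprn_ge0.
have h0 n : 0 <= h n by rewrite mulr_ge0 ?subr_ge0// invr_ge0 exprn_ge0.
have wS n : w n = w n.+1 + w n.+1.
  by rewrite /w exprS; field; rewrite expf_neq0.
have hS n : h n = h n.+1 + h n.+1.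
  by rewrite /h exprS; field; rewrite expf_neq0.
pose K (n : nat) (z : R * R) := circulation z.1 (z.1 + w n) z.2 (z.2 + h n).
have step n z : exists z' : R * R, [/\ z.1 <= z'.1, z'.1 + w n.+1 <= z.1 + w n,
    z.2 <= z'.2, z'.2 + h n.+1 <= z.2 + h n & `|K n z| <= 4 * `|K n.+1 z'|].
  have := circulation_quarter z.1 (z.1 + w n) z.2 (z.2 + h n) (z.1 + w n.+1) (z.2 + h n.+1).
  rewrite wS hS !addrA -/(w n.+1).
  have := w0 n.+1; have := h0 n.+1 => ? ?.
  case=> H; [exists z|exists (z.1 + w n.+1, z.2)|exists (z.1, z.2 + h n.+1)|
    exists (z.1 + w n.+1, z.2 + h n.+1)]; split => //=; try lra;
    by rewrite /K wS hS !addrA.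
pose nxt n z := projT1 (cid (step n z)).
pose fix s n := if n is n'.+1 then nxt n' (s n') else (a, c).
have sP n : [/\ (s n).1 <= (s n.+1).1, (s n.+1).1 + w n.+1 <= (s n).1 + w n,
    (s n).2 <= (s n.+1).2, (s n.+1).2 + h n.+1 <= (s n).2 + h n &
    `|K n (s n)| <= 4 * `|K n.+1 (s n.+1)|].
  by rewrite /= /nxt; case: cid.
(* Nested intervals $[u_n,u_n+v_n]$ have a common point; applied to each coordinate, this gives the
   point on which the chosen quarters close in. *)
have lim_exists (u v : nat -> R) : (forall n, u n <= u n.+1) ->
    (forall n, 0 <= v n) ->
    (forall n, u n.+1 + v n.+1 <= u n + v n) ->
    exists l, forall n, u n <= l <= u n + v n.
  move=> uS v0 vS.
  have und : nondecreasing_seq u by apply/nondecreasing_seqP.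
  have vni : nonincreasing_seq (u \+ v) by apply/nonincreasing_seqP.
  have ub m n : u m <= u n + v n.
    rewrite (le_trans (und _ _ (leq_maxl m n)))//.
    rewrite (le_trans _ (vni _ _ (leq_maxr m n)))//= lerDl//.
  have cu : cvgn u.
    by apply: nondecreasing_is_cvgn => //; exists (u 0%N + v 0%N) => _ [n _ <-].
  exists (limn u) => n; rewrite nondecreasing_cvgn_le//=.
  by apply: limr_le => //; near=> m; exact: ub.
have [x0 Hx0] : exists l, forall n, (s n).1 <= l <= (s n).1 + w n.
  by apply: lim_exists => // n; case: (sP n).
have [y0 Hy0] : exists l, forall n, (s n).2 <= l <= (s n).2 + h n.
  by apply: lim_exists => // n; case: (sP n).
have KE n : `|circulation a b c d| <= 4 ^+ n * `|K n (s n)|.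
  elim: n => [|n IH]; first by rewrite expr0 mul1r /K /w /h /= expr0 !divr1 !subrKC.
  rewrite (le_trans IH)// exprSr -mulrA ler_wpM2l ?exprn_ge0//.
  by case: (sP n).
have [A [B [C [tp tq]]]] := closed_form x0 y0.
apply/eqP; rewrite -normr_le0; apply/ler_addgt0Pr => e e0; rewrite add0r.
pose T := b - a + (d - c).
have T0 : 0 <= T by rewrite addr_ge0// subr_ge0.
(* The factor $4^n$ will cancel against $(T/2^n)^2$, leaving the bound $2T^2e'$. The $+1$ keeps the
   denominator positive when the rectangle is a point. *)
pose e' := e / (2 * T ^+ 2 + 1).
have den0 : 0 < 2 * T ^+ 2 + 1 by rewrite ltr_wpDl// mulr_ge0// sqr_ge0.
have e'0 : 0 < e' by rewrite divr_gt0.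
have [dp dp0 Hp] := tp _ e'0; have [dq dq0 Hq] := tq _ e'0.
have [n Hn] : exists n, T / 2 ^+ n < Num.min dp dq.
  have m0 : 0 < Num.min dp dq by rewrite lt_min dp0.
  exists (Num.truncn (T / Num.min dp dq)).+1.
  rewrite ltr_pdivrMr ?exprn_gt0// -ltr_pdivrMl// mulrC.
  rewrite (lt_le_trans (truncnS_gt _))//.
  by rewrite -natrX ler_nat; apply: ltnW; apply: ltn_expl.
have wT : w n + h n = T / 2 ^+ n by rewrite /w /h -mulrDl.
have near_ok x y : (s n).1 <= x <= (s n).1 + w n -> (s n).2 <= y <= (s n).2 + h n ->
    [/\ `|x - x0| + `|y - y0| <= w n + h n, `|x - x0| < Num.min dp dq &
     `|y - y0| < Num.min dp dq].
  move=> /andP[x1 x2] /andP[y1 y2]; have /andP[u1 u2] := Hx0 n; have /andP[v1 v2] := Hy0 n.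
  have X : `|x - x0| <= w n by rewrite ler_norml; move: x1 x2 u1 u2; clear; lra.
  have Y : `|y - y0| <= h n by rewrite ler_norml; move: y1 y2 v1 v2; clear; lra.
  split; [exact: lerD|apply: le_lt_trans Hn; rewrite -wT|
    apply: le_lt_trans Hn; rewrite -wT].
  - by rewrite (le_trans X)// lerDl.
  - by rewrite (le_trans Y)// lerDr.
rewrite (le_trans (KE n))//.
have KB : `|K n (s n)| <= 2 * (e' * (T / 2 ^+ n)) * (T / 2 ^+ n).
  rewrite -[X in _ * X]wT.
  rewrite [w n + h n](_ : _ = (s n).1 + w n - (s n).1 + ((s n).2 + h n - (s n).2)); last by ring.
  apply: (@circulation_local x0 y0 A B C); rewrite ?lerDl//.
  - move=> x y xr yr; have [n1 n2 n3] := near_ok _ _ xr yr.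
    have := Hp (x - x0) (y - y0).
    rewrite !subrKC; move: n2 n3; rewrite !lt_min => /andP[n2 _] /andP[n3 _] /(_ n2 n3).
    by move=> /le_trans; apply; rewrite ler_wpM2l ?(ltW e'0)// -wT.
  - move=> x y xr yr; have [n1 n2 n3] := near_ok _ _ xr yr.
    have := Hq (x - x0) (y - y0).
    rewrite !subrKC; move: n2 n3; rewrite !lt_min => /andP[_ n2] /andP[_ n3] /(_ n2 n3).
    by move=> /le_trans; apply; rewrite ler_wpM2l ?(ltW e'0)// -wT.
apply: le_trans (ler_wpM2l _ KB) _; first by rewrite exprn_ge0.
have -> : 4 ^+ n * (2 * (e' * (T / 2 ^+ n)) * (T / 2 ^+ n)) = e' * (2 * T ^+ 2).
  have -> : 4 ^+ n = 2 ^+ n * 2 ^+ n :> R by rewrite -exprMn; congr (_ ^+ _); ring.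
  by field; rewrite expf_neq0.
rewrite /e' -mulrA ler_piMr ?(ltW e0)// mulrC ler_pdivrMr// mul1r lerDl//.
Unshelve. all: by end_near. Qed.

Lemma circulation0 (a b c d : R) : circulation a b c d = 0.
Proof.
have swapx x y z t : circulation x y z t = - circulation y x z t.
  by rewrite /circulation; ring.
have swapy x y z t : circulation x y z t = - circulation x y t z.
  by rewrite /circulation; ring.
have [ab|/ltW ab] := leP a b; have [cd|/ltW cd] := leP c d.
- exact: circulation0_le.
- by rewrite swapy circulation0_le ?oppr0.
- by rewrite swapx circulation0_le ?oppr0.
- by rewrite swapy swapx circulation0_le ?oppr0.
Qed.

End Primitive.

Lemma tdiff_is_derive p (x y A B : R) : tdiff p x y A B ->
  is_derive x 1 (p^~ y) A /\ is_derive y 1 (p x) B.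
Proof.
move=> pd; split; apply/is_derive_epsP => e e0; have [d d0 Hd] := pd e e0;
  exists d => // h hd.
- by have := Hd h 0 hd; rewrite normr0 !addr0 mulr0 subr0 => /(_ d0).
- have := Hd 0 h; rewrite normr0 addr0 add0r => /(_ d0 hd).
  by rewrite mulr0 subr0.
Qed.

Lemma is_derive_continuous g (x D : R) : is_derive x 1 g D -> {for x, continuous g}.
Proof.
by case=> + _ => /derivable1_diffP; exact: differentiable_continuous.
Qed.

(** The potential integrates from the origin along the horizontal axis and then vertically, so its
    $y$-derivative is immediate. Vanishing circulation allows the other order, vertical and then
    horizontal, which gives the $x$-derivative. *)
Lemma closed_form_exact p q :
  (forall x y, exists A B C, tdiff p x y A B /\ tdiff q x y B C) ->
  exists Phi : R -> R -> R, forall x y : R,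
    is_derive x 1 (Phi^~ y) (p x y) /\ is_derive y 1 (Phi x) (q x y).
Proof.
move=> pq.
have [P dP] : exists P : R -> R -> R, forall y x : R, is_derive x 1 (P y) (p x y).
  have H y : exists G : R -> R, forall x : R, is_derive x 1 G (p x y).
    apply: (@antiderivative (p^~ y)) => x.
    have [A [B [C [/tdiff_is_derive[/is_derive_continuous]]]]] := pq x y.
    by [].
  by have [P HP] := choice H; exists P.
have [Q dQ] : exists Q : R -> R -> R, forall x y : R, is_derive y 1 (Q x) (q x y).
  have H x : exists G : R -> R, forall y : R, is_derive y 1 G (q x y).
    apply: (@antiderivative (q x)) => y.
    have [A [B [C [_ /tdiff_is_derive[_ /is_derive_continuous]]]]] := pq x y.
    by [].
  by have [Q HQ] := choice H; exists Q.
have Z (a b c d : R) : circulation (fun x y => P y x) Q a b c d = 0.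
  exact: (@circulation0 p q).
exists (fun x y => P 0 x - P 0 0 + (Q x y - Q x 0)) => x y; split; last first.
  apply: (is_derive_eq (is_deriveD (is_derive_cst (P 0 x - P 0 0) _ _)
    (is_deriveB (dQ x y) (is_derive_cst (Q x 0) _ _)))).
  by rewrite subr0 add0r.
rewrite (_ : (fun _ => _) = (fun x => P y x + (Q 0 y - Q 0 0 - P y 0))).
  by rewrite -[p x y]addr0; exact: is_deriveD.
apply/funext => t; have := Z 0 t 0 y; rewrite /circulation => H.
apply/eqP; rewrite -subr_eq0 -[X in _ == X]H; apply/eqP; ring.
Qed.

End Goursat.

(** * The identity theorem *)

Section PowerInverse.
Variables (K : numFieldType) (N : nat).
Implicit Types z : K^o.

Lemma is_derive_exprV z : z != 0 ->
  is_derive z 1 (fun z : K^o => (z ^+ N)^-1 : K^o)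
    (- (z ^+ N) ^- 2 * (N%:R * z ^+ N.-1)).
Proof.
move=> z0; have zN : z ^+ N != 0 by rewrite expf_neq0.
have dX := @exprn_derivable K N z 1.
apply: DeriveDef; first exact: (@derivableV _ _ (@GRing.exp K ^~ N) _ _ zN dX).
by rewrite (@deriveV _ _ (@GRing.exp K ^~ N) _ _ zN dX) exp_derive /GRing.scale/= mulr1.
Qed.

Lemma derivable_exprV2 z : z != 0 ->
  derivable (fun z : K^o => - (z ^+ N) ^- 2 * (N%:R * z ^+ N.-1) : K^o) z 1.
Proof.
move=> z0; have zN : (z ^+ N) ^+ 2 != 0 by rewrite !expf_neq0.
have dX n := @exprn_derivable K n z 1.
have d2 : derivable (fun z : K^o => (z ^+ N) ^+ 2 : K^o) z 1.
  exact: (derivableM (dX N) (dX N)).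
have d3 := derivableN (@derivableV _ _ (fun z : K^o => (z ^+ N) ^+ 2) _ _ zN d2).
exact: (derivableM d3 (derivableM (derivable_cst (N%:R : K^o) z 1) (dX N.-1))).
Qed.

End PowerInverse.

(** * Complex differentiability in real coordinates, primitives and the maximum principle *)

Section ComplexDerivative.
Variable R : realType.
Local Notation C := R[i].
Implicit Types (F : C -> C) (d : C).
Local Notation cderive F z d := (is_derive (z : C^o) 1 (F : C^o -> C^o) d).

Lemma normr_normc (z : C) : `|z| = (normc z)%:C. Proof. by []. Qed.

Lemma normc_ge0 (z : C) : 0 <= normc z.
Proof. by rewrite -ler0c -normr_normc normr_ge0. Qed.

Lemma ler_Re_normc (z : C) : `|complex.Re z| <= normc z.
Proof. by rewrite -lecR -normr_normc; exact: normc_ge_Re. Qed.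

Lemma ler_Im_normc (z : C) : `|complex.Im z| <= normc z.
Proof.
have := ler_Re_normc (z * 'i); rewrite ReiNIm normrN normcM => /le_trans; apply.
by rewrite [normc 'i](_ : _ = 1) ?mulr1//= expr0n expr1n add0r sqrtr1.
Qed.

Lemma normc_le_ReIm (z : C) : normc z <= `|complex.Re z| + `|complex.Im z|.
Proof.
case: z => x y /=.
have s0 : 0 <= `|x| + `|y| by rewrite addr_ge0.
rewrite -(ler_pXn2r (n := 2)) ?nnegrE ?sqrtr_ge0//.
rewrite sqr_sqrtr ?addr_ge0 ?sqr_ge0// sqrrD !real_normK ?num_real//.
by rewrite -addrAC lerDl mulrn_wge0// mulr_ge0.
Qed.

(** The norm of [R[i]] takes its values in [R[i]]. Passing to the real-valued [normc] makes the
    errors and radii real, as in [tdiff]. *)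
Lemma cderive_epsP F (z : C) d : cderive F z d <->
  (forall e : R, 0 < e -> exists2 r : R, 0 < r &
    forall h : C, normc h < r -> normc (F (z + h) - F z - d * h) <= e * normc h).
Proof.
split=> [gD e e0|H].
- have e0' : 0 < e%:C by rewrite ltcR.
  have /cvgrPdist_le /(_ _ e0') : h^-1 *: ((F : C^o -> C^o) (h *: 1 + z) - F z) @[h --> (0 : C^o)^'] --> (d : C^o).
    by case: gD => dg <-; exact: dg.
  case=> r /= r0 Hd; exists (complex.Re r); first by move: r0; rewrite ltcE/= => /andP[].
  have rE : r = (complex.Re r)%:C by rewrite RRe_real// gtr0_real.
  move=> h hd.
  have [->|h0] := eqVneq h 0; first by rewrite addr0 mulr0 subrr subr0 normc0 mulr0.
  have := Hd h; rewrite /= sub0r normrN rE normr_normc ltcR => /(_ hd h0).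
  rewrite -(ler_pM2r (_ : 0 < `|h|)) ?normr_gt0// -normrM mulrBl distrC.
  rewrite [h *: 1]mulr1 -[h^-1 *: _]/(h^-1 * _) mulrAC mulVf// mul1r (addrC h).
  by rewrite !normr_normc -rmorphM lecR.
- have lim : h^-1 *: ((F : C^o -> C^o) (h *: 1 + z) - F z) @[h --> (0 : C^o)^'] --> (d : C^o).
    apply/cvgrPdist_le => e e0.
    have eE : e = (complex.Re e)%:C by rewrite RRe_real// gtr0_real.
    have [|r r0 Hd] := H (complex.Re e); first by move: e0; rewrite ltcE/= => /andP[].
    exists (r%:C); first by rewrite /= ltcR.
    move=> h /=; rewrite sub0r normrN normr_normc ltcR => hd h0.
    rewrite -(ler_pM2r (_ : 0 < `|h|)) ?normr_gt0// -normrM mulrBl distrC.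
    rewrite [h *: 1]mulr1 -[h^-1 *: _]/(h^-1 * _) mulrAC mulVf// mul1r (addrC h).
    by rewrite !normr_normc eE -rmorphM lecR; exact: Hd.
  by apply: DeriveDef; [apply/cvg_ex; exists d|apply/cvg_lim].
Qed.

(** The Cauchy-Riemann equations: multiplication by $d=d_1+\mathrm i d_2$ has the real matrix with
    rows $(d_1,-d_2)$ and $(d_2,d_1)$. *)
Lemma cderive_tdiffP F x y d : cderive F (x +i* y) d <->
  tdiff (fun x y => complex.Re (F (x +i* y))) x y (complex.Re d) (- complex.Im d) /\
  tdiff (fun x y => complex.Im (F (x +i* y))) x y (complex.Im d) (complex.Re d).
Proof.
have decomp s t : let X := F ((x +i* y) + (s +i* t)) - F (x +i* y) - d * (s +i* t) in
   (complex.Re (F ((x + s) +i* (y + t))) - complex.Re (F (x +i* y)) -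
      complex.Re d * s - - complex.Im d * t = complex.Re X) /\
   (complex.Im (F ((x + s) +i* (y + t))) - complex.Im (F (x +i* y)) -
      complex.Im d * s - complex.Re d * t = complex.Im X).
  move=> X; rewrite /X -[x +i* y + _]/((x + s) +i* (y + t)).
  case: (F (_ +i* _)) => a b; case: (F (_ +i* _)) => a' b'; case: d {X} => d1 d2 /=.
  by split; ring.
split=> [/cderive_epsP H|[H1 H2]].
- split=> e e0; have [r r0 Hr] := H e e0; (exists (r / 2); first by rewrite divr_gt0);
    move=> s t hs ht; have [E1 E2] := decomp s t; rewrite ?E1 ?E2.
  + apply: le_trans (ler_Re_normc _) _; apply: le_trans (Hr _ _) _.
      by rewrite (le_lt_trans (normc_le_ReIm _))//= (splitr r) ltrD.
    by rewrite ler_pM2l// normc_le_ReIm.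
  + apply: le_trans (ler_Im_normc _) _; apply: le_trans (Hr _ _) _.
      by rewrite (le_lt_trans (normc_le_ReIm _))//= (splitr r) ltrD.
    by rewrite ler_pM2l// normc_le_ReIm.
- apply/cderive_epsP => e e0; have e4 : 0 < e / 4 by rewrite divr_gt0.
  have [r1 r10 Hr1] := H1 _ e4; have [r2 r20 Hr2] := H2 _ e4.
  exists (Num.min r1 r2) => [|[s t]]; first by rewrite lt_min r10.
  rewrite lt_min => /andP[h1 h2]; have [E1 E2] := decomp s t.
  have B1 := ler_Re_normc (s +i* t); have B2 := ler_Im_normc (s +i* t).
  have := Hr1 s t (le_lt_trans B1 h1) (le_lt_trans B2 h1); rewrite E1 => {}Hr1.
  have := Hr2 s t (le_lt_trans B1 h2) (le_lt_trans B2 h2); rewrite E2 => {}Hr2.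
  apply: le_trans (normc_le_ReIm _) _; apply: le_trans (lerD Hr1 Hr2) _.
  move: B1 B2 e0 => /= B1 B2 e0; nra.
Qed.

Lemma tdiff_continuous (p : R -> R -> R) x y A B : tdiff p x y A B ->
  forall e : R, 0 < e -> exists2 r, 0 < r & forall s t : R, `|s| < r -> `|t| < r ->
    `|p (x + s) (y + t) - p x y| <= e.
Proof.
move=> pd e e0; have [r r0 Hr] := pd 1 ltr01.
pose M := 1 + `|A| + `|B|; have M0 : 0 < M by rewrite /M -addrA ltr_pwDl// addr_ge0.
exists (Num.min r (e / (2 * M))) => [|s t].
  by rewrite lt_min r0 divr_gt0// mulr_gt0.
rewrite !lt_min => /andP[s1 s2] /andP[t1 t2].
have := Hr s t s1 t1; rewrite mul1r => H.
have -> : p (x + s) (y + t) - p x y =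
  (p (x + s) (y + t) - p x y - A * s - B * t) + A * s + B * t by ring.
rewrite (le_trans (ler_normD _ _))// (le_trans (lerD (ler_normD _ _) (lexx _)))//.
rewrite !normrM; have sM : M * (`|s| + `|t|) <= e.
  rewrite -ler_pdivlMl// mulrC.
  have -> : e / M = e / (2 * M) + e / (2 * M) by field; rewrite gt_eqF.
  by rewrite lerD// ltW.
apply: le_trans sM; rewrite /M; have := normr_ge0 s; have := normr_ge0 t.
have := normr_ge0 A; have := normr_ge0 B; move: H.
set a := `|A|; set b := `|B|; set s' := `|s|; set t' := `|t|; move=> *; nra.
Qed.

(** The increment is split into a horizontal and a vertical leg. On each leg the mean value
    inequality is applied after subtracting the linear part with slope taken at $(x,y)$. *)
Lemma continuous_partials_tdiff (p A B : R -> R -> R) (x y : R) :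
  (forall x y : R, is_derive x 1 (p^~ y) (A x y) /\ is_derive y 1 (p x) (B x y)) ->
  (forall e : R, 0 < e -> exists2 r, 0 < r & forall s t : R, `|s| < r -> `|t| < r ->
    `|A (x + s) (y + t) - A x y| <= e) ->
  (forall e : R, 0 < e -> exists2 r, 0 < r & forall s t : R, `|s| < r -> `|t| < r ->
    `|B (x + s) (y + t) - B x y| <= e) ->
  tdiff p x y (A x y) (B x y).
Proof.
move=> dp cA cB e e0; have [r1 r10 H1] := cA _ e0; have [r2 r20 H2] := cB _ e0.
exists (Num.min r1 r2) => [|s t]; first by rewrite lt_min r10.
rewrite !lt_min => /andP[s1 s2] /andP[t1 t2].
have h1 : `|p (x + s) (y + t) - p x (y + t) - A x y * s| <= e * `|s|.
  rewrite (_ : _ - _ - _ = (p (x + s) (y + t) - A x y * (x + s)) - (p x (y + t) - A x y * x)); last by ring.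
  rewrite [X in _ <= e * `|X|](_ : s = x + s - x); last by ring.
  apply: (@mean_value_le_sym R (fun z => p z (y + t) - A x y * z) (fun z => A z (y + t) - A x y)).
  - move=> z _; have [d1 _] := dp z (y + t).
    apply: (is_derive_eq (is_deriveB d1 (@is_deriveZ _ _ _ id (A x y) z 1 1 (is_derive_id _ _)))).
    by rewrite /GRing.scale/= mulr1.
  - move=> z zs; rewrite -[z](subrKC x); apply: H1 => //.
    by rewrite (le_lt_trans zs)// addrAC subrr add0r.
have h2 : `|p x (y + t) - p x y - B x y * t| <= e * `|t|.
  rewrite (_ : _ - _ - _ = (p x (y + t) - B x y * (y + t)) - (p x y - B x y * y)); last by ring.
  rewrite [X in _ <= e * `|X|](_ : t = y + t - y); last by ring.
  apply: (@mean_value_le_sym R (fun z => p x z - B x y * z) (fun z => B x z - B x y)).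
  - move=> z _; have [_ d1] := dp x z.
    apply: (is_derive_eq (is_deriveB d1 (@is_deriveZ _ _ _ id (B x y) z 1 1 (is_derive_id _ _)))).
    by rewrite /GRing.scale/= mulr1.
  - move=> z zs; rewrite -[z](subrKC y) -[X in B X _ - _]addr0; apply: H2 => //.
      by rewrite normr0.
    by rewrite (le_lt_trans zs)// addrAC subrr add0r.
rewrite mulrDr; apply: le_trans (lerD h1 h2).
apply: le_trans (ler_normD _ _); rewrite le_eqVlt; apply/orP; left; apply/eqP.
by congr (`| _ |); ring.
Qed.

(** By Cauchy-Riemann the forms $u\,dx-v\,dy$ and $v\,dx+u\,dy$ are closed. Their potentials are the
    real and imaginary parts of a primitive; these are totally differentiable because their partials
    $u$, $v$ are continuous. *)
Lemma entire_primitive F (F' : C -> C) : (forall z, cderive F z (F' z)) ->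
  exists G : C -> C, forall z, cderive G z (F z).
Proof.
move=> dF.
pose u x y := complex.Re (F (x +i* y)); pose v x y := complex.Im (F (x +i* y)).
have du x y : tdiff u x y (complex.Re (F' (x +i* y))) (- complex.Im (F' (x +i* y))).
  by have /cderive_tdiffP[] := dF (x +i* y).
have dv x y : tdiff v x y (complex.Im (F' (x +i* y))) (complex.Re (F' (x +i* y))).
  by have /cderive_tdiffP[] := dF (x +i* y).
have dvN x y : tdiff (fun x y => - v x y) x y (- complex.Im (F' (x +i* y))) (- complex.Re (F' (x +i* y))).
  move=> e e0; have [r r0 Hr] := dv x y e e0; exists r => // s t hs ht.
  rewrite -normrN (le_trans _ (Hr s t hs ht))// le_eqVlt; apply/orP; left.
  by apply/eqP; congr (`| _ |); ring.
have [U dU] : exists Phi : R -> R -> R, forall x y : R,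
    is_derive x 1 (Phi^~ y) (u x y) /\ is_derive y 1 (Phi x) (- v x y).
  apply: closed_form_exact => x y; do 3 eexists; split; [exact: du|exact: dvN].
have [V dV] : exists Phi : R -> R -> R, forall x y : R,
    is_derive x 1 (Phi^~ y) (v x y) /\ is_derive y 1 (Phi x) (u x y).
  apply: closed_form_exact => x y; do 3 eexists; split; [exact: dv|exact: du].
exists (fun z => U (complex.Re z) (complex.Im z) +i* V (complex.Re z) (complex.Im z)).
case=> x y; apply/cderive_tdiffP; split => /=.
- apply: (@continuous_partials_tdiff U u (fun x y => - v x y)) => //.
  + exact: tdiff_continuous (du x y).
  + exact: tdiff_continuous (dvN x y).
- apply: (@continuous_partials_tdiff V v u) => //.
  + exact: tdiff_continuous (dv x y).
  + exact: tdiff_continuous (du x y).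
Qed.


(** At the maximum $g'(c)=0$. If $D$ were positive, $g'$ would be positive just to the right of $c$,
    and $g$ would exceed $g(c)$ there. *)
Lemma second_derivative_le0 (g g1 : R -> R) (a b c D : R) : a < c < b ->
  (forall x : R, is_derive x 1 g (g1 x)) -> is_derive c 1 g1 D ->
  (forall x : R, a < x < b -> g x <= g c) -> D <= 0.
Proof.
move=> /andP[ac cb] dg dg1 gmax; rewrite leNgt; apply/negP => D0.
have g1c : g1 c = 0.
  have H : is_derive c 1 g 0.
    apply: (@derive1_at_max R g a b c (ltW (lt_trans ac cb))).
    - by move=> t _; case: (dg t).
    - by rewrite in_itv/= ac.
    - by move=> t; rewrite in_itv/=; exact: gmax.
  by have [_ <-] := dg c; case: H.
have D2 : 0 < D / 2 by rewrite divr_gt0.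
have /is_derive_epsP /(_ _ D2)[r r0 Hr] := dg1.
pose h := Num.min (r / 2) ((b - c) / 2).
have h0 : 0 < h by rewrite lt_min !divr_gt0// subr_gt0.
have hr : h < r by rewrite gt_min gtr_pMr// invf_lt1// ltr1n.
have hb : c + h < b.
  rewrite -ltrBrDl gt_min; apply/orP; right; rewrite gtr_pMr ?subr_gt0//.
  by rewrite invf_lt1// ltr1n.
have g1pos x : c < x <= c + h -> 0 < g1 x.
  move=> /andP[cx xh]; have := Hr (x - c).
  have xc0 : 0 < x - c by rewrite subr_gt0.
  rewrite subrKC g1c subr0 ger0_norm ?(ltW xc0)// => /(_ _)/ler_normlP[|].
    by rewrite (le_lt_trans _ hr)// lerBlDl.
  have := mulr_gt0 D2 xc0; set k := x - c => *; nra.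
have [||z] := @MVT R g g1 c (c + h).
- by rewrite ltrDl.
- by apply: derivable_within_continuous => x _; case: (dg x).
rewrite in_itv/= => /andP[z1 z2] E.
have := gmax (c + h); rewrite hb (lt_trans ac) ?ltrDl// => /(_ isT).
rewrite -subr_le0 E leNgt => /negP; apply.
by rewrite mulr_gt0 ?g1pos ?z1 ?(ltW z2)// addrAC subrr add0r.
Qed.

(* At an interior maximum of W + k (x^2 + y^2) both second derivatives would be <= 0,
   but their sum is 4k. *)
Lemma harmonic_max_principle (W Wx Wxx Wy Wyy : R -> R -> R) (L M : R) : 0 < L ->
  (forall x y : R, is_derive x 1 (W^~ y) (Wx x y) /\ is_derive y 1 (W x) (Wy x y)) ->
  (forall x y : R, is_derive x 1 (Wx^~ y) (Wxx x y)) ->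
  (forall x y : R, is_derive y 1 (Wy x) (Wyy x y)) ->
  (forall x y : R, Wxx x y + Wyy x y = 0) ->
  continuous (fun z : R * R => W z.1 z.2) ->
  (forall x y : R, `|x| <= L -> `|y| <= L -> (`|x| == L) || (`|y| == L) -> W x y <= M) ->
  forall x y : R, `|x| <= L -> `|y| <= L -> W x y <= M.
Proof.
move=> L0 dW dWx dWy harm cW bd x y xL yL.
apply/ler_addgt0Pr => e e0.
(* With this $k$ the perturbation $k(x^2+y^2)$ is at most $2kL^2=e$ on the square, so a bound at its
   maximum point costs only $e$. *)
pose k := e / (2 * L ^+ 2); have k0 : 0 < k by rewrite divr_gt0// mulr_gt0// exprn_gt0.
have kL : 2 * k * L ^+ 2 = e by rewrite /k; field; rewrite gt_eqF.
pose H (z : R * R) := W z.1 z.2 + k * (z.1 ^+ 2 + z.2 ^+ 2).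
have cH : continuous H.
  move=> z; apply: cvgD; first exact: cW.
  by apply: cvgMl_tmp; apply: cvgD; apply: cvgM; (exact: cvg_fst || exact: cvg_snd).
have [|||[a b]] := @compact_EVT_max (R * R)%type R H (`[- L, L] `*` `[- L, L]).
- by exists (0, 0); split; rewrite /= in_itv/= oppr_le0 ltW.
- by apply: compact_setX; exact: segment_compact.
- exact: continuous_subspaceT.
rewrite inE => -[] /=; rewrite !in_itv/= -!ler_norml => aL bL Hmax.
have Hm (s t : R) : `|s| <= L -> `|t| <= L -> H (s, t) <= H (a, b).
  by move=> sL tL; apply: Hmax; rewrite inE; split; rewrite /= in_itv/= -ler_norml.
have sqL (s : R) : `|s| <= L -> s ^+ 2 <= L ^+ 2.
  by move=> sL; rewrite -(real_normK (num_real s)) lerXn2r// nnegrE// ltW.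
suff Hab : W a b <= M.
  have := Hm x y xL yL; rewrite /H/= => H1.
  have := sqL a aL; have := sqL b bL; have := sqr_ge0 x; have := sqr_ge0 y.
  move: Hab H1 kL k0; clear; move: (W x y) (W a b) => w1 w2.
  move: (x ^+ 2) (y ^+ 2) (a ^+ 2) (b ^+ 2) (L ^+ 2) => x2 y2 a2 b2 L2; nra.
have [|/norP[aL' bL']] := boolP ((`|a| == L) || (`|b| == L)); first exact: bd.
have {aL aL'}aL : `|a| < L by rewrite lt_neqAle aL'.
have {bL bL'}bL : `|b| < L by rewrite lt_neqAle bL'.
have d2 (w c : R) : is_derive w 1 (fun s : R => k * (s ^+ 2 + c)) (k * (2 * w)).
  have d1 := is_deriveD (@is_deriveX _ _ _ 2 w 1 1 (is_derive_id _ _)) (is_derive_cst c w 1).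
  by apply: (is_derive_eq (@is_deriveZ _ _ _ _ k w 1 _ d1)); rewrite /GRing.scale/= addr0 expr1 mulr1.
have d2' (w c : R) : is_derive w 1 (fun s : R => k * (c + s ^+ 2)) (k * (2 * w)).
  have d1 := is_deriveD (is_derive_cst c w 1) (@is_deriveX _ _ _ 2 w 1 1 (is_derive_id _ _)).
  by apply: (is_derive_eq (@is_deriveZ _ _ _ _ k w 1 _ d1)); rewrite /GRing.scale/= add0r expr1 mulr1.
have d3 (w : R) : is_derive w 1 (fun s : R => k * (2 * s)) (k * 2).
  have d1 := @is_deriveZ _ _ _ id (2 : R) w 1 1 (is_derive_id _ _).
  by apply: (is_derive_eq (@is_deriveZ _ _ _ _ k w 1 _ d1)); rewrite /GRing.scale/= mulr1.
have X : Wxx a b + k * 2 <= 0.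
  apply: (@second_derivative_le0 (fun s => H (s, b)) (fun s => Wx s b + k * (2 * s)) (- L) L a).
  - by rewrite -ltr_norml.
  - by move=> s; have [d1 _] := dW s b; exact: (is_deriveD d1 (d2 s (b ^+ 2))).
  - by move=> s; rewrite -ltr_norml => sL; apply: Hm; exact: ltW.
have Y : Wyy a b + k * 2 <= 0.
  apply: (@second_derivative_le0 (fun s => H (a, s)) (fun s => Wy a s + k * (2 * s)) (- L) L b).
  - by rewrite -ltr_norml.
  - by move=> s; have [_ d1] := dW a s; exact: (is_deriveD d1 (d2' s (a ^+ 2))).
  - by move=> s; rewrite -ltr_norml => sL; apply: Hm; exact: ltW.
have := harm a b; have := addr_ge0 (ltW k0) (ltW k0); move: X Y k0; clear => *; lra.
Qed.


Lemma tdiff_continuous2 (p : R -> R -> R) :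
  (forall x y, exists A B, tdiff p x y A B) -> continuous (fun z : R * R => p z.1 z.2).
Proof.
move=> pd -[x y]; have [A [B dp]] := pd x y.
apply/cvgrPdist_le => e e0; have [r r0 Hr] := tdiff_continuous dp e0.
exists (ball x r, ball y r); first by split; exact: nbhsx_ballx.
move=> -[s t] [/= sx ty]; have := Hr (s - x) (t - y).
rewrite !subrKC => H.
by rewrite distrC; apply: H; rewrite distrC; [exact: sx|exact: ty].
Qed.

(** The origin is joined to $(x,y)$ by a horizontal and then a vertical segment, so the partials
    have to vanish only on these two segments. *)
Lemma zero_partials_cst (p A B : R -> R -> R) (x y : R) :
  (forall x y : R, is_derive x 1 (p^~ y) (A x y) /\ is_derive y 1 (p x) (B x y)) ->
  (forall s, `|s| <= `|x| -> A s 0 = 0) -> (forall t, `|t| <= `|y| -> B x t = 0) ->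
  p x y = p 0 0.
Proof.
move=> dp A0 B0.
have h1 : `|p x 0 - p 0 0| <= 0 * `|x - 0|.
  apply: (@mean_value_le_sym R (p^~ 0) (A^~ 0)) => z; rewrite !subr0.
  - by move=> _; case: (dp z 0).
  - by move=> /A0 ->; rewrite normr0.
have h2 : `|p x y - p x 0| <= 0 * `|y - 0|.
  apply: (@mean_value_le_sym R (p x) (B x)) => z; rewrite !subr0.
  - by move=> _; case: (dp x z).
  - by move=> /B0 ->; rewrite normr0.
move: h1 h2; rewrite !mul0r !normr_le0 !subr_eq0 => /eqP <- /eqP.
by [].
Qed.

Lemma cderive_lines F (F' : C -> C) : (forall z, cderive F z (F' z)) ->
  forall x y : R,
  (is_derive x 1 (fun x => complex.Re (F (x +i* y))) (complex.Re (F' (x +i* y))) /\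
   is_derive y 1 (fun y => complex.Re (F (x +i* y))) (- complex.Im (F' (x +i* y)))) /\
  (is_derive x 1 (fun x => complex.Im (F (x +i* y))) (complex.Im (F' (x +i* y))) /\
   is_derive y 1 (fun y => complex.Im (F (x +i* y))) (complex.Re (F' (x +i* y)))).
Proof.
move=> dF x y; have /cderive_tdiffP[d1 d2] := dF (x +i* y).
by split; [exact: (tdiff_is_derive d1)|exact: (tdiff_is_derive d2)].
Qed.

Lemma normcX (z : C) n : normc (z ^+ n) = normc z ^+ n.
Proof. by elim: n => [|n IH]; rewrite ?normc1// !exprS normcM IH. Qed.

Lemma normc_mono (x y s t : R) : `|s| <= `|x| -> `|t| <= `|y| ->
  normc (s +i* t) <= normc (x +i* y).
Proof.
move=> sx ty; rewrite /= ler_sqrt ?addr_ge0 ?sqr_ge0//.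
by rewrite lerD// -[leLHS]real_normK ?num_real// -[leRHS]real_normK ?num_real// lerXn2r// nnegrE.
Qed.

Lemma cderive_near0 F (z : C) (r : R) : normc z < r ->
  (forall w, normc w < r -> F w = 0) -> cderive F z 0.
Proof.
move=> zr F0; apply/cderive_epsP => e e0; exists (r - normc z); first by rewrite subr_gt0.
move=> h hr; rewrite !F0// ?mul0r ?subrr ?normc0 ?mulr_ge0 ?normc_ge0 ?(ltW e0)//.
by rewrite (le_lt_trans (le_normcD _ _))// -ltrBrDl.
Qed.

Lemma cderive_unique F z d d' : cderive F z d -> cderive F z d' -> d = d'.
Proof. by move=> [_ <-] [_ <-]. Qed.

Lemma cderive_cst0 z : cderive (fun=> 0) z 0.
Proof. exact: is_derive_cst. Qed.

Section Identity.
Variables (h F : C -> C) (delta : R).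
Hypothesis dF : forall z, cderive F z (h z).
Hypothesis dh : forall z, exists d, cderive h z d.
Hypothesis delta_gt0 : 0 < delta.
Hypothesis F0 : forall z, normc z < delta -> F z = 0.

Let h0 z : normc z < delta -> h z = 0.
Proof.
by move=> zd; apply: (cderive_unique (dF z)); apply: cderive_near0 zd _.
Qed.

Let normc_eq0 (z : C) : (normc z == 0) = (z == 0).
Proof. by apply/eqP/eqP => [/eq0_normc//|->]; rewrite normc0. Qed.

Let K N (z : C^o) : C^o := (z ^+ N)^-1.
Let K1 N (z : C^o) : C^o := - (z ^+ N) ^- 2 * (N%:R * z ^+ N.-1).

Let dK N (z : C^o) : z != 0 -> cderive (K N) z (K1 N z).
Proof. exact: is_derive_exprV. Qed.

Let dK1 N (z : C^o) : z != 0 -> exists d, cderive (K1 N) z d.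
Proof. by move=> z0; eexists; apply: derivableP; exact: derivable_exprV2. Qed.

(** The maximum principle applies to the harmonic function $\mathrm{Re}(cF/z^N)$, and $|z|\ge L$ on
    the boundary of the square. The free factor $c$ serves to recover the modulus from the real
    part. *)
Lemma flat_bound (L M : R) N (c z : C) : 0 < L -> 0 <= M ->
  (forall x y : R, `|x| <= L -> `|y| <= L -> normc (F (x +i* y)) <= M) ->
  `|complex.Re z| <= L -> `|complex.Im z| <= L ->
  complex.Re (c * (F z / z ^+ N)) <= normc c * (M / L ^+ N).
Proof.
move=> L0 M0 FM zL1 zL2.
pose G z := c * (F z * K N z); pose G1 z := c * (h z * K N z + F z * K1 N z).
have dG w : cderive G w (G1 w).
  (* Near 0 both $F$ and $h$ vanish, hence so do [G] and [G1], whatever value the inverse takes at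
     0. Elsewhere the product rule applies. *)
  have [wd|wd] := ltP (normc w) delta.
    rewrite /G1 h0// F0// !mul0r addr0 mulr0; apply: cderive_near0 wd _ => w' /F0.
    by rewrite /G => ->; rewrite mul0r mulr0.
  have w0 : w != 0 by apply: contraTneq wd => ->; rewrite normc0 -ltNge.
  apply: (is_derive_eq (@is_deriveZ _ _ _ _ c _ _ _ (@is_deriveM _ _ _ _ _ _ _ _ (dF w) (dK N w0)))).
  by rewrite /G1 /GRing.scale/= addrC; congr (c * (_ + _)); rewrite mulrC.
have dG1 w : exists d, cderive G1 w d.
  have [wd|wd] := ltP (normc w) delta.
    exists 0; apply: cderive_near0 wd _ => w' wd'.
    by rewrite /G1 h0// F0// !mul0r addr0 mulr0.
  have w0 : w != 0 by apply: contraTneq wd => ->; rewrite normc0 -ltNge.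
  have [d1 d1P] := dh w; have [d2 d2P] := dK1 N w0.
  eexists; exact: (@is_deriveZ _ _ _ _ c _ _ _ (is_deriveD
    (@is_deriveM _ _ _ _ _ _ _ _ d1P (dK N w0))
    (@is_deriveM _ _ _ _ _ _ _ _ (dF w) d2P))).
have [G2 dG2] := choice dG1.
have := @harmonic_max_principle (fun x y => complex.Re (G (x +i* y)))
  (fun x y => complex.Re (G1 (x +i* y))) (fun x y => complex.Re (G2 (x +i* y)))
  (fun x y => - complex.Im (G1 (x +i* y))) (fun x y => - complex.Re (G2 (x +i* y)))
  L (normc c * (M / L ^+ N)) L0.
case: z zL1 zL2 => x0 y0 /= x0L y0L; apply => //.
- by move=> x y; case: (cderive_lines dG x y).
- by move=> x y; case: (cderive_lines dG2 x y) => -[].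
- by move=> x y; apply: is_deriveN; case: (cderive_lines dG2 x y) => _ [].
- by move=> x y; rewrite subrr.
- apply: (@tdiff_continuous2 (fun x y => complex.Re (G (x +i* y)))) => x y.
  by have /cderive_tdiffP[? _] := dG (x +i* y); do 2 eexists; eassumption.
- move=> x y xL yL bd; rewrite (le_trans (ler_norm _))// (le_trans (ler_Re_normc _))//.
  rewrite /G !normcM ler_wpM2l ?normc_ge0// ler_pM ?normc_ge0//; first exact: FM.
  rewrite /K normcV normcX lef_pV2 ?posrE ?exprn_gt0//; last first.
    case/orP: bd => /eqP E; rewrite (lt_le_trans L0)// -E.
      exact: (ler_Re_normc (x +i* y)).
    exact: (ler_Im_normc (x +i* y)).
  rewrite lerXn2r ?nnegrE ?normc_ge0 ?(ltW L0)//.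
  case/orP: bd => /eqP E; rewrite -{1}E.
    exact: (ler_Re_normc (x +i* y)).
  exact: (ler_Im_normc (x +i* y)).
Qed.

(** Taking $c=\overline w$ with $w=F(z)/z^N$ turns $\mathrm{Re}(cw)$ into $|w|^2$, so that $|w|\le
    M/L^N$. The choice $L=|z|+1$ makes the ratio $|z|/L$ less than 1, and $N$ tends to infinity. *)
Lemma flat_eq0 z : F z = 0.
Proof.
have [->|z0] := eqVneq z 0; first by rewrite F0// normc0.
have nz0 : 0 < normc z by rewrite lt_neqAle eq_sym normc_eq0 z0 normc_ge0.
pose L := normc z + 1; have L0 : 0 < L by rewrite addr_gt0.
have zL : normc z <= L by rewrite lerDl.
have [M M0 FM] : exists2 M, 0 <= M &
    forall x y : R, `|x| <= L -> `|y| <= L -> normc (F (x +i* y)) <= M.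
  have tF x y := iffLR (cderive_tdiffP _ _ _ _) (dF (x +i* y)).
  pose u x y := complex.Re (F (x +i* y)); pose v x y := complex.Im (F (x +i* y)).
  have [|||w _ Hw] := @compact_EVT_max (R * R)%type R (fun z => `|u z.1 z.2| + `|v z.1 z.2|)
    (`[- L, L] `*` `[- L, L]).
  - by exists (0, 0); split; rewrite /= in_itv/= oppr_le0 ltW.
  - by apply: compact_setX; exact: segment_compact.
  - apply: continuous_subspaceT => w; apply: cvgD; apply: cvg_norm.
    + apply: (@tdiff_continuous2 u) => x y; case: (tF x y) => ? _.
      by do 2 eexists; eassumption.
    + apply: (@tdiff_continuous2 v) => x y; case: (tF x y) => _ ?.
      by do 2 eexists; eassumption.
  exists (`|u w.1 w.2| + `|v w.1 w.2|); first by rewrite addr_ge0.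
  move=> x y xL yL; apply: le_trans (normc_le_ReIm _) _.
  by apply: (Hw (x, y)); rewrite inE; split; rewrite /= in_itv/= -ler_norml.
pose q := normc z / L.
have q1 : `|q| < 1.
  by rewrite ger0_norm ?divr_ge0 ?normc_ge0 ?(ltW L0)// ltr_pdivrMr// mul1r ltrDl.
have bound N : normc (F z) <= geometric M q N.
  have := @flat_bound L M N (conjc (F z / z ^+ N)) z L0 M0 FM
    (le_trans (ler_Re_normc _) zL) (le_trans (ler_Im_normc _) zL).
  set w := F z / z ^+ N.
  have -> : complex.Re (w^*%C * w) = normc w ^+ 2.
    by case: (w) => a b /=; rewrite sqr_sqrtr ?addr_ge0 ?sqr_ge0//; ring.
  have -> : normc w^*%C = normc w by case: (w) => a b /=; rewrite sqrrN.
  have [w0 _|w0] := eqVneq w 0.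
    have -> : F z = 0.
      by move/eqP: w0; rewrite mulf_eq0 invr_eq0 expf_eq0 (negPf z0) andbF orbF => /eqP.
    by rewrite normc0 /= mulr_ge0// exprn_ge0// divr_ge0 ?normc_ge0 ?(ltW L0).
  have nw : 0 < normc w by rewrite lt_neqAle eq_sym normc_eq0 w0 normc_ge0.
  rewrite expr2 ler_pM2l// /w normcM normcV normcX ler_pdivrMr ?exprn_gt0//.
  by move=> /le_trans; apply; rewrite /= /q expr_div_n mulrAC mulrA.
apply: eq0_normc; apply/eqP; rewrite eq_le normc_ge0 andbT.
rewrite -(cvg_lim (@Rhausdorff R) (cvg_geometric M q1)).
apply: limr_ge; first by apply/cvg_ex; exists 0; exact: cvg_geometric.
exact: nearW.
Qed.

End Identity.

(** The primitive normalized at 0 vanishes on the disc, since its partials are components of $h$,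
    which vanish along the two segments from 0. [flat_eq0] makes it vanish everywhere, and $h$ is
    its derivative. *)
Lemma entire_identity (h h' : C -> C) (delta : R) :
  (forall z, cderive h z (h' z)) -> 0 < delta ->
  (forall z, normc z < delta -> h z = 0) -> forall z, h z = 0.
Proof.
move=> dh d0 hz; have [F dF] := entire_primitive dh.
pose G z := F z - F 0.
have dG z : cderive G z (h z).
  by apply: (is_derive_eq (is_deriveB (dF z) (is_derive_cst (F 0 : C^o) _ _))); rewrite subr0.
have G0 z : normc z < delta -> G z = 0.
  case: z => x y zd.
  have hx s : `|s| <= `|x| -> h (s +i* 0) = 0.
    by move=> sx; apply: hz; apply: le_lt_trans zd; apply: normc_mono; rewrite ?normr0.
  have hy t : `|t| <= `|y| -> h (x +i* t) = 0.
    by move=> ty; apply: hz; apply: le_lt_trans zd; apply: normc_mono.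
  have E1 : complex.Re (F (x +i* y)) = complex.Re (F 0).
    apply: (@zero_partials_cst (fun x y => complex.Re (F (x +i* y)))
      (fun x y => complex.Re (h (x +i* y))) (fun x y => - complex.Im (h (x +i* y)))).
    - by move=> s t; case: (cderive_lines dF s t).
    - by move=> s /hx ->.
    - by move=> t /hy ->; rewrite oppr0.
  have E2 : complex.Im (F (x +i* y)) = complex.Im (F 0).
    apply: (@zero_partials_cst (fun x y => complex.Im (F (x +i* y)))
      (fun x y => complex.Im (h (x +i* y))) (fun x y => complex.Re (h (x +i* y)))).
    - by move=> s t; case: (cderive_lines dF s t).
    - by move=> s /hx ->.
    - by move=> t /hy ->.
  by apply/eqP; rewrite subr_eq0 eq_complex E1 E2 !eqxx.
have Gz z : G z = 0 by apply: (@flat_eq0 h G delta) => // w; exists (h' w).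
move=> z; apply: (cderive_unique (dG z)).
by rewrite (_ : G = fun=> 0); [exact: cderive_cst0|apply/funext].
Qed.

End ComplexDerivative.

(** * Entire power series *)

Section EntireCoefficients.
Variable R : realType.
Implicit Types (a b c : nat -> R) (x y t rho : R).

(** Infinite radius of convergence, phrased through bounded terms: this form is easily inherited,
    and using it at $2\rho$ gives back geometric decay at $\rho$. *)
Definition entire_coef a := forall rho, 0 <= rho ->
  exists C, forall k, `|a k| * rho ^+ k <= C.

Lemma entire_coef_geometric a rho : entire_coef a -> 0 <= rho ->
  exists2 C, 0 <= C & forall k, `|a k| * rho ^+ k <= geometric C 2^-1 k.
Proof.
move=> ea r0; have [C HC] := ea (2 * rho) (mulr_ge0 (ler0n _ 2) r0).
exists C => [|k]; first by apply: le_trans (HC 0%N); rewrite expr0 mulr1.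
have := HC k; rewrite /= exprMn mulrCA exprVn ler_pdivlMr ?exprn_gt0//.
by rewrite mulrC.
Qed.

Lemma entire_coef_bounded_mul a c M : entire_coef a -> (forall k, `|c k| <= M) ->
  entire_coef (fun k => c k * a k).
Proof.
move=> ea cM rho r0; have [C HC] := ea _ r0; exists (M * C) => k.
by rewrite normrM -mulrA ler_pM// mulr_ge0// exprn_ge0.
Qed.

Lemma entire_coef_nat_mul a : entire_coef a -> entire_coef (fun k => k%:R * a k).
Proof.
move=> ea rho r0; have [C HC] := ea (2 * rho) (mulr_ge0 (ler0n _ 2) r0).
exists C => k; apply: le_trans (HC k); rewrite normrM exprMn normr_nat.
rewrite [leLHS](_ : _ = `|a k| * rho ^+ k * k%:R); last by ring.
rewrite [leRHS](_ : _ = `|a k| * rho ^+ k * 2 ^+ k); last by ring.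
rewrite ler_wpM2l ?mulr_ge0 ?exprn_ge0// -natrX ler_nat.
by apply: ltnW; apply: ltn_expl.
Qed.

(** The bound is taken at $1+\rho$ instead of $\rho$, because $\rho$ may be 0 and cannot be divided
    out. *)
Lemma entire_coef_shift a : entire_coef a -> entire_coef (fun k => a k.+1).
Proof.
move=> ea rho r0; have [C HC] := ea (1 + rho) (addr_ge0 ler01 r0).
exists C => k; apply: le_trans (HC k.+1); rewrite ler_wpM2l//.
apply: (@le_trans _ _ ((1 + rho) ^+ k)).
  by rewrite lerXn2r ?nnegrE ?addr_ge0// lerDr.
by rewrite exprS ler_peMl ?exprn_ge0 ?addr_ge0// lerDl.
Qed.

Lemma sum_geometric_half (C : R) m n : (m <= n)%N ->
  \sum_(m <= k < n) geometric C 2^-1 k = 2 * C * 2^-1 ^+ m - 2 * C * 2^-1 ^+ n.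
Proof.
move=> mn; rewrite -(subnKC mn); elim: (n - m)%N => [|d IH].
  by rewrite addn0 big_geq// subrr.
by rewrite addnS big_nat_recr ?leq_addr//= IH exprS; field.
Qed.

Lemma sum_geometric_half_le (C : R) m n : 0 <= C ->
  \sum_(m <= k < n) geometric C 2^-1 k <= 2 * C * 2^-1 ^+ m.
Proof.
move=> C0; have [nm|mn] := leqP n m.
  by rewrite big_geq// mulr_ge0 ?mulr_ge0// exprn_ge0.
rewrite sum_geometric_half ?(ltnW mn)// lerBlDr lerDl.
by rewrite mulr_ge0 ?mulr_ge0// exprn_ge0.
Qed.

Lemma entire_coef_series_cvg a (u : nat -> R) rho : entire_coef a -> 0 <= rho ->
  (forall k, `|u k| <= `|a k| * rho ^+ k) -> cvgn (series u).
Proof.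
move=> ea r0 Hu; have [C C0 HC] := entire_coef_geometric ea r0.
apply: normed_cvg; apply: (series_le_cvg (v_ := geometric C 2^-1)).
- by move=> k; exact: normr_ge0.
- by move=> k; rewrite /= mulr_ge0// exprn_ge0.
- by move=> k; apply: le_trans (Hu k) (HC k).
- apply: is_cvg_geometric_series; rewrite ger0_norm// invf_lt1// ltr1n//.
Qed.

Lemma entire_coef_pseries_cvg a x : entire_coef a -> cvgn (pseries a x).
Proof.
move=> ea; apply: (entire_coef_series_cvg (rho := `|x|) ea) => // k.
by rewrite normrM normrX.
Qed.

Lemma entire_coef_diffs a : entire_coef a -> entire_coef (pseries_diffs a).
Proof. by move=> /entire_coef_nat_mul /entire_coef_shift. Qed.

Lemma is_derive_pseries a x : entire_coef a ->
  is_derive x 1 (fun x => limn (pseries a x)) (limn (pseries (pseries_diffs a) x)).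
Proof.
move=> ea; apply: (@pseries_snd_diffs _ _ (`|x| + 1)).
- exact: entire_coef_pseries_cvg.
- by apply: entire_coef_pseries_cvg; exact: entire_coef_diffs.
- by apply: entire_coef_pseries_cvg; do 2 apply: entire_coef_diffs.
- by rewrite [ltRHS]ger0_norm ?addr_ge0// ltrDl.
Qed.

Lemma pseries_at0 a : limn (pseries a 0) = a 0%N.
Proof.
apply: cvg_lim => //; apply/cvgrPdist_le => e e0; exists 1%N => // n /= n1.
rewrite /pseries /series/= -(prednK n1) big_nat_recl// expr0 mulr1.
rewrite big1 ?addr0 ?subrr ?normr0 ?(ltW e0)// => i _.
by rewrite expr0n mulr0.
Qed.

(** Value at 0 for the constant term; for the others, the induction hypothesis is applied to the
    derived series, hence the generalization over $a$. *)
Lemma pseries_eq0 a : entire_coef a -> (forall x, limn (pseries a x) = 0) ->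
  forall k, a k = 0.
Proof.
move=> ea a0 k; elim: k a ea a0 => [|k IH] a ea a0; first by rewrite -pseries_at0.
have := IH (pseries_diffs a) (entire_coef_diffs ea).
rewrite /pseries_diffs => H; have {H} : k.+1%:R * a k.+1 = 0.
  apply: H => x; have := is_derive_pseries x ea.
  rewrite (_ : (fun x => _) = cst 0); last exact/funext.
  move=> H1; have := is_derive_cst (0 : R) x 1; case: H1 => _ <-.
  by case.
by move/eqP; rewrite mulf_eq0 pnatr_eq0/= => /eqP.
Qed.

Lemma sum_nat_extend (F : nat -> R) m n : (m <= n)%N ->
  (forall j, (m <= j)%N -> F j = 0) ->
  \sum_(0 <= j < m) F j = \sum_(0 <= j < n) F j.
Proof.
move=> mn F0; rewrite (@big_cat_nat _ _ _ m 0 n)//=.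
rewrite [X in _ + X](_ : _ = 0) ?addr0// big_nat_cond big1// => j.
by move=> /andP[/andP[mj _] _]; exact: F0.
Qed.

Lemma binomial_sum_le x t k J : 0 <= x -> 0 <= t ->
  \sum_(0 <= j < J) 'C(k, j)%:R * x ^+ (k - j) * t ^+ j <= (x + t) ^+ k.
Proof.
move=> x0 t0; pose F j := 'C(k, j)%:R * x ^+ (k - j) * t ^+ j.
have F0 j : 0 <= F j by rewrite !mulr_ge0 ?exprn_ge0.
have -> : (x + t) ^+ k = \sum_(0 <= j < k.+1) F j.
  rewrite big_mkord exprDn; apply: eq_bigr => j _.
  by rewrite /F -mulr_natl mulrA.
rewrite (@sum_nat_extend _ k.+1 (maxn J k.+1)) ?leq_maxr//; last first.
  by move=> j kj; rewrite /F bin_small// !mul0r.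
by rewrite (@big_cat_nat _ _ _ J 0 (maxn J k.+1)) ?leq_maxl//= lerDl sumr_ge0.
Qed.

Lemma binomial_term_le x t k j : 0 <= x -> 0 <= t ->
  'C(k, j)%:R * x ^+ (k - j) * t ^+ j <= (x + t) ^+ k.
Proof.
move=> x0 t0; apply: le_trans (binomial_sum_le k j.+1 x0 t0).
rewrite big_nat_recr//= lerDr sumr_ge0// => i _.
by rewrite !mulr_ge0 ?exprn_ge0.
Qed.

(* The coefficient of t^j in the expansion of sum_k a_k (x + t)^k. *)
Definition taylor_coef a x j := limn (series (fun k => a k * 'C(k, j)%:R * x ^+ (k - j))).

Lemma taylor_coef_cvg a x j : entire_coef a ->
  cvgn (series (fun k => a k * 'C(k, j)%:R * x ^+ (k - j))).
Proof.
move=> ea; apply: (entire_coef_series_cvg (rho := `|x| + 1) ea) => [|k].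
  by rewrite addr_ge0.
rewrite -mulrA !normrM normr_nat normrX ler_wpM2l//.
by have := @binomial_term_le `|x| 1 k j (normr_ge0 _) ler01; rewrite expr1n mulr1.
Qed.

(** Absolute summability of the double series in finite form: after exchanging the sums, the sum
    over $j$ is at most $(|x|+|t|)^k$ and a geometric tail in $k$ is left. The bound does not depend
    on $J$. Used with $K=0$ it bounds the Taylor coefficients; used with $J=K$ it justifies the
    rearrangement. *)
Lemma taylor_coef_tail a x t C K J : entire_coef a -> 0 <= C ->
  (forall k, `|a k| * (`|x| + `|t|) ^+ k <= geometric C 2^-1 k) ->
  \sum_(0 <= j < J) `|t| ^+ j * `|taylor_coef a x j -
     \sum_(0 <= k < K) a k * 'C(k, j)%:R * x ^+ (k - j)| <= 2 * C * 2^-1 ^+ K.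
Proof.
move=> ea C0 HC.
pose D M j := \sum_(0 <= k < M) a k * 'C(k, j)%:R * x ^+ (k - j).
have cv : (fun M => \sum_(0 <= j < J) `|t| ^+ j * `|D M j - D K j|) @ \oo -->
    \sum_(0 <= j < J) `|t| ^+ j * `|taylor_coef a x j - D K j|.
  apply: cvg_big => [|j _]; [exact: add_continuous|apply: cvgMl_tmp]; apply: cvg_norm; apply: cvgB; last exact: cvg_cst.
  exact: taylor_coef_cvg.
rewrite -(cvg_lim (@Rhausdorff R) cv); apply: limr_le; first by apply/cvg_ex; eexists; exact: cv.
exists K => // M /= KM.
apply: (@le_trans _ _ (\sum_(0 <= j < J) \sum_(K <= k < M)
    `|a k| * ('C(k, j)%:R * `|x| ^+ (k - j) * `|t| ^+ j))).
  apply: ler_sum => j _; rewrite /D (@big_cat_nat _ _ _ K 0 M)//= addrAC subrr add0r.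
  apply: le_trans (ler_wpM2l _ (ler_norm_sum _ _ _)) _; first by rewrite exprn_ge0.
  rewrite mulr_sumr; apply: ler_sum => k _.
  by rewrite !normrM normr_nat normrX le_eqVlt; apply/orP; left; apply/eqP; ring.
rewrite exchange_big/=; apply: le_trans (sum_geometric_half_le K M C0).
apply: ler_sum => k _; rewrite -mulr_sumr; apply: le_trans (HC k).
by rewrite ler_wpM2l// binomial_sum_le.
Qed.

Lemma entire_taylor_coef a x : entire_coef a -> entire_coef (taylor_coef a x).
Proof.
move=> ea rho r0.
have [C C0 HC] := entire_coef_geometric ea (addr_ge0 (normr_ge0 x) r0).
exists (2 * C) => j; have := @taylor_coef_tail a x rho C 0 j.+1 ea C0.
rewrite (ger0_norm r0) => /(_ HC); rewrite expr0 mulr1; apply: le_trans.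
have E0 : \sum_(0 <= k < 0) a k * 'C(k, j)%:R * x ^+ (k - j) = 0 by rewrite big_geq.
rewrite big_nat_recr//= E0 subr0 mulrC lerDr sumr_ge0// => i _.
by rewrite mulr_ge0// exprn_ge0.
Qed.

(** The two partial sums of order $K$ differ by $\sum_{j<K}c_jt^j$ times the tail of the $j$-th
    Taylor coefficient, which tends to 0 by [taylor_coef_tail]. *)
Lemma binomial_rearrangement a c x t : entire_coef a -> (forall j, `|c j| <= 1) ->
  (fun K => \sum_(0 <= k < K) a k *
     \sum_(0 <= j < k.+1) 'C(k, j)%:R * c j * x ^+ (k - j) * t ^+ j) @ \oo -->
  limn (pseries (fun j => c j * taylor_coef a x j) t).
Proof.
move=> ea c1.
have [C C0 HC] := entire_coef_geometric ea (addr_ge0 (normr_ge0 x) (normr_ge0 t)).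
have cT : cvgn (pseries (fun j => c j * taylor_coef a x j) t).
  apply: entire_coef_pseries_cvg; apply: (entire_coef_bounded_mul (M := 1)) => //.
  exact: entire_taylor_coef.
apply: cvg_sub0 cT.
have g0 : geometric (2 * C) 2^-1 n @[n --> \oo] --> (0 : R).
  by apply: cvg_geometric; rewrite ger0_norm// invf_lt1// ltr1n.
apply: (squeeze_cvgr (f := fun n => - geometric (2 * C) 2^-1 n) (h := geometric (2 * C) 2^-1)) => //.
  apply: nearW => K; rewrite -ler_norml.
  rewrite [X in `|X|](_ : _ = - \sum_(0 <= j < K) c j * t ^+ j * (taylor_coef a x j -
     \sum_(0 <= k < K) a k * 'C(k, j)%:R * x ^+ (k - j))); last first.
    rewrite !fctE /pseries /series/= -sumrN.
    under eq_big_nat => k /andP[_ kK].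
      rewrite (@sum_nat_extend _ k.+1 K)//; last first.
        by move=> j kj; rewrite bin_small// !mul0r.
      rewrite mulr_sumr. over.
    rewrite exchange_big/= -sumrN -big_split/=; apply: eq_bigr => j _.
    rewrite mulrBr opprB mulr_sumr; congr (_ - _); last by ring.
    by apply: eq_bigr => k _; ring.
  rewrite normrN; apply: le_trans (ler_norm_sum _ _ _) _.
  apply: le_trans (taylor_coef_tail K K ea C0 HC).
  by apply: ler_sum => j _; rewrite !normrM normrX -mulrA ler_piMl// mulr_ge0// exprn_ge0.
by rewrite -oppr0; apply: cvgN.
Qed.


(** Differentiating $m$ times commutes with re-expanding at $x$. Termwise it is the identity $\binom
    kj\frac{(k+m)!}{k!}=\frac{(j+m)!}{j!}\binom{k+m}{j+m}$. *)
Lemma taylor_coef_shift a x j m : entire_coef a ->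
  taylor_coef (fun k => (k + m)`!%:R / k`!%:R * a (k + m)%N) x j =
  (j + m)`!%:R / j`!%:R * taylor_coef a x (j + m).
Proof.
move=> ea; apply: cvg_lim => //.
have fact_neq0 k : (k`!%:R : R) != 0 by rewrite pnatr_eq0 -lt0n fact_gt0.
have H := @taylor_coef_cvg a x (j + m) ea.
rewrite (_ : series _ = fun K => (j + m)`!%:R / j`!%:R *
    series (fun k => a k * 'C(k, j + m)%:R * x ^+ (k - (j + m))) (K + m)%N).
  by apply: cvgMl_tmp; rewrite (cvg_shiftn m (series _)).
apply/funext => K; rewrite /series/= (@big_cat_nat _ _ _ m 0 (K + m)) ?leq_addl//=.
rewrite [X in _ * (X + _)](_ : _ = 0) ?add0r; last first.
  rewrite big_nat_cond big1// => k /andP[/andP[_ km] _].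
  by rewrite bin_small ?mulr0 ?mul0r// (leq_trans km)// leq_addl.
have -> : \sum_(m <= i < K + m) a i * 'C(i, j + m)%:R * x ^+ (i - (j + m)) =
    \sum_(0 <= k < K) a (k + m)%N * 'C(k + m, j + m)%:R * x ^+ (k + m - (j + m)).
  by rewrite -{1}[m]add0n big_addn addnK.
rewrite mulr_sumr; apply: eq_bigr => k _.
rewrite subnDr.
have [kj|jk] := ltnP k j.
  by rewrite !bin_small ?ltn_add2r// !(mulr0, mul0r).
have E1 : (k`!%:R : R) = 'C(k, j)%:R * (j`!%:R * (k - j)`!%:R).
  by rewrite -!natrM bin_fact.
have E2 : ((k + m)`!%:R : R) = 'C(k + m, j + m)%:R * ((j + m)`!%:R * (k - j)`!%:R).
  by rewrite -(subnDr m k j) -!natrM bin_fact// leq_add2r.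
have C0 : ('C(k, j)%:R : R) != 0 by rewrite pnatr_eq0 -lt0n bin_gt0.
by rewrite E1 E2; field; rewrite C0 !fact_neq0.
Qed.

End EntireCoefficients.

(** * Power series in a complex variable *)

Section ComplexSeries.
Variable R : realType.
Local Notation C := R[i].
Local Notation cderive F z d := (is_derive (z : C^o) 1 (F : C^o -> C^o) d).
Implicit Types (a : nat -> R) (z h : C).

(** Convergence component by component, so that only limits of real sequences are handled. *)
Definition ccvg (s : nat -> C) (l : C) :=
  ((fun n => complex.Re (s n)) @ \oo --> complex.Re l) /\
  ((fun n => complex.Im (s n)) @ \oo --> complex.Im l).

Lemma ccvgB s s' l l' : ccvg s l -> ccvg s' l' -> ccvg (fun n => s n - s' n) (l - l').
Proof.
move=> [r i] [r' i']; split.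
- rewrite (_ : (fun n => _) = (fun n => complex.Re (s n) - complex.Re (s' n))).
    by rewrite raddfB; exact: cvgB.
  by apply/funext => n; rewrite raddfB.
- rewrite (_ : (fun n => _) = (fun n => complex.Im (s n) - complex.Im (s' n))).
    by rewrite raddfB; exact: cvgB.
  by apply/funext => n; rewrite raddfB.
Qed.

Lemma ccvgMr s l h : ccvg s l -> ccvg (fun n => s n * h) (l * h).
Proof.
case: h => h1 h2 [r i]; split.
- rewrite (_ : (fun n => _) = (fun n => complex.Re (s n) * h1 - complex.Im (s n) * h2)).
    rewrite (_ : complex.Re _ = complex.Re l * h1 - complex.Im l * h2); last by case: (l).
    by apply: cvgB; apply: cvgMr_tmp.
  by apply/funext => n; case: (s n).
- rewrite (_ : (fun n => _) = (fun n => complex.Re (s n) * h2 + complex.Im (s n) * h1)).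
    rewrite (_ : complex.Im _ = complex.Re l * h2 + complex.Im l * h1); last by case: (l).
    by apply: cvgD; apply: cvgMr_tmp.
  by apply/funext => n; case: (s n).
Qed.

Lemma ccvg_shift s l : ccvg s l -> ccvg (fun n => s n.+1) l.
Proof.
move=> [r i]; split.
- by rewrite (cvg_shiftS (fun n => complex.Re (s n))).
- by rewrite (cvg_shiftS (fun n => complex.Im (s n))).
Qed.

Lemma ccvg_norm_le s l B : ccvg s l -> (forall n, normc (s n) <= B) -> normc l <= B + B.
Proof.
move=> [r i] sB; apply: le_trans (normc_le_ReIm _) _; apply: lerD.
- rewrite -(cvg_lim (@Rhausdorff R) (cvg_norm r)); apply: limr_le.
    by apply/cvg_ex; eexists; exact: (cvg_norm r).
  by apply: nearW => n; apply: le_trans (ler_Re_normc _) (sB n).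
- rewrite -(cvg_lim (@Rhausdorff R) (cvg_norm i)); apply: limr_le.
    by apply/cvg_ex; eexists; exact: (cvg_norm i).
  by apply: nearW => n; apply: le_trans (ler_Im_normc _) (sB n).
Qed.

Definition cseries a z : C :=
  limn (series (fun k => a k * complex.Re (z ^+ k))) +i*
  limn (series (fun k => a k * complex.Im (z ^+ k))).

Lemma Re_csum a z n : complex.Re (\sum_(0 <= k < n) (a k)%:C * z ^+ k) =
  series (fun k => a k * complex.Re (z ^+ k)) n.
Proof.
rewrite /series/=; elim: n => [|n IH]; first by rewrite !big_geq.
rewrite !big_nat_recr//= -IH; case: (\sum_(_ <= _ < _) _) => p q.
by case: (z ^+ n) => r s /=; rewrite mul0r subr0.
Qed.

Lemma Im_csum a z n : complex.Im (\sum_(0 <= k < n) (a k)%:C * z ^+ k) =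
  series (fun k => a k * complex.Im (z ^+ k)) n.
Proof.
rewrite /series/=; elim: n => [|n IH]; first by rewrite !big_geq.
rewrite !big_nat_recr//= -IH; case: (\sum_(_ <= _ < _) _) => p q.
by case: (z ^+ n) => r s /=; rewrite mul0r addr0.
Qed.

Lemma cseries_cvg a z : entire_coef a ->
  ccvg (fun n => \sum_(0 <= k < n) (a k)%:C * z ^+ k) (cseries a z).
Proof.
move=> ea; split.
- rewrite (_ : (fun n => _) = series (fun k => a k * complex.Re (z ^+ k))); last first.
    by apply/funext => n; rewrite Re_csum.
  apply: (entire_coef_series_cvg ea (normc_ge0 z)) => k.
  by rewrite normrM ler_wpM2l// -normcX ler_Re_normc.
- rewrite (_ : (fun n => _) = series (fun k => a k * complex.Im (z ^+ k))); last first.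
    by apply/funext => n; rewrite Im_csum.
  apply: (entire_coef_series_cvg ea (normc_ge0 z)) => k.
  by rewrite normrM ler_wpM2l// -normcX ler_Im_normc.
Qed.

Lemma normc_real (r : R) : normc r%:C = `|r|.
Proof. by rewrite /normc/= expr0n/= addr0 sqrtr_sqr. Qed.

(** If $R_k$ denotes the remainder, $R_{k+1}=(z+h)R_k+kz^{k-1}h^2$. The condition $\rho\ge 1$ lets
    all lower powers be replaced by the highest one. *)
Lemma power_remainder_le z h (rho : R) k : 1 <= rho -> normc z <= rho ->
  normc (z + h) <= rho ->
  normc ((z + h) ^+ k - z ^+ k - k%:R * z ^+ k.-1 * h) <=
    k%:R * k%:R * rho ^+ k * normc h ^+ 2.
Proof.
move=> r1 zr zhr; have r0 : 0 <= rho by exact: le_trans r1.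
have nk j : normc (j%:R : C) = j%:R.
  by rewrite -(rmorph_nat (real_complex R)) normc_real normr_nat.
elim: k => [|k IH]; first by rewrite !expr0 subrr !mul0r subrr normc0.
have -> : (z + h) ^+ k.+1 - z ^+ k.+1 - k.+1%:R * z ^+ k * h =
   (z + h) * ((z + h) ^+ k - z ^+ k - k%:R * z ^+ k.-1 * h) +
   k%:R * z ^+ k.-1 * h ^+ 2.
  case: k {IH} => [|k]; first by rewrite !expr0 !expr1; ring.
  by rewrite /= -[k.+2%:R]natr1 !exprS; ring.
rewrite (le_trans (le_normcD _ _))// !normcM !normcX nk.
apply: (@le_trans _ _ (rho * (k%:R * k%:R * rho ^+ k * normc h ^+ 2) +
   k%:R * rho ^+ k.+1 * normc h ^+ 2)).
  apply: lerD; first by rewrite ler_pM ?normc_ge0.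
  rewrite -(expr2 (normc h)) ler_wpM2r ?exprn_ge0 ?normc_ge0// ler_wpM2l//.
  apply: (@le_trans _ _ (rho ^+ k.-1)); first by rewrite lerXn2r ?nnegrE ?normc_ge0.
  by apply: ler_weXn2l => //; rewrite (leq_trans (leq_pred _)).
rewrite -subr_ge0 [X in 0 <= X](_ : _ =
    k%:R * (rho ^+ k.+1 * normc h ^+ 2) + rho ^+ k.+1 * normc h ^+ 2).
  by rewrite addr_ge0 ?mulr_ge0 ?exprn_ge0 ?normc_ge0.
by rewrite -[k.+1%:R]natr1 exprS; ring.
Qed.

Lemma cseries_derive a z : entire_coef a ->
  cderive (cseries a) z (cseries (pseries_diffs a) z).
Proof.
move=> ea; pose rho := normc z + 1; have r1 : 1 <= rho by rewrite lerDr normc_ge0.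
have r0 : 0 <= rho by exact: le_trans r1.
have zr : normc z <= rho by rewrite lerDl.
have [M M0 HM] := entire_coef_geometric (entire_coef_nat_mul (entire_coef_nat_mul ea)) r0.
apply/cderive_epsP => e e0.
(* The geometric sum gives $2M|h|^2$, and [ccvg_norm_le] doubles it, whence $4M$. The bound 1 keeps
   $z+h$ in the disc of radius $\rho=|z|+1$. *)
exists (Num.min 1 (e / (4 * M + 1))) => [|h].
  by rewrite lt_min ltr01 divr_gt0// ltr_wpDl// mulr_ge0.
rewrite lt_min => /andP[h1 h2].
have zhr : normc (z + h) <= rho by rewrite (le_trans (le_normcD _ _))// lerD2l ltW.
have cv := ccvgB (ccvgB (ccvg_shift (cseries_cvg (z + h) ea)) (ccvg_shift (cseries_cvg z ea)))
  (ccvgMr h (cseries_cvg z (entire_coef_diffs ea))).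
have H := @ccvg_norm_le _ _ (2 * M * normc h ^+ 2) cv.
apply: le_trans (H _) _ => [n|]; last first.
  have H2 : normc h * (4 * M + 1) <= e.
    by rewrite -ler_pdivlMr ?ltW// ltr_wpDl// mulr_ge0.
  have := normc_ge0 h; move: H2 M0; move: (normc h) => y; clear; nra.
rewrite [X in normc X](_ : _ = \sum_(0 <= k < n.+1) (a k)%:C *
    ((z + h) ^+ k - z ^+ k - k%:R * z ^+ k.-1 * h)); last first.
  rewrite -sumrB mulr_suml.
  have -> : \sum_(0 <= k < n) (pseries_diffs a k)%:C * z ^+ k * h =
    \sum_(0 <= k < n.+1) (a k)%:C * (k%:R * z ^+ k.-1 * h).
    rewrite big_nat_recl// mul0r mul0r mulr0 add0r; apply: eq_bigr => k _.
    by rewrite /pseries_diffs rmorphM rmorph_nat/=; ring.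
  by rewrite -sumrB; apply: eq_bigr => k _; ring.
have nsum (u : nat -> C) m : normc (\sum_(0 <= k < m) u k) <= \sum_(0 <= k < m) normc (u k).
  elim: m => [|m IH]; first by rewrite !big_geq// normc0.
  by rewrite !big_nat_recr//= (le_trans (le_normcD _ _))// lerD2r.
apply: le_trans (nsum _ _) _.
apply: (@le_trans _ _ (\sum_(0 <= k < n.+1) geometric M 2^-1 k * normc h ^+ 2)).
  apply: ler_sum => k _; rewrite normcM.
  rewrite [normc (a k)%:C](_ : _ = `|a k|); last by rewrite normc_real.
  apply: le_trans (ler_wpM2l (normr_ge0 _) (power_remainder_le k r1 zr zhr)) _.
  rewrite mulrA ler_wpM2r ?exprn_ge0 ?normc_ge0//; apply: le_trans (HM k).
  by rewrite !normrM normr_nat le_eqVlt; apply/orP; left; apply/eqP; ring.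
rewrite -mulr_suml ler_wpM2r ?exprn_ge0 ?normc_ge0//.
by have := sum_geometric_half_le 0 n.+1 M0; rewrite expr0 mulr1.
Qed.

Lemma entire_eq_cseries (f : C -> C) a :
  (forall z : C^o, derivable (f : C^o -> C^o) z 1) ->
  (\forall z \near (0 : C^o),
    (series (fun k => (a k)%:C * z ^+ k) : (C^o)^nat) @ \oo --> (f z : C^o)) ->
  entire_coef a -> forall z, f z = cseries a z.
Proof.
move=> df fa ea z.
have dg w := cseries_derive w ea.
pose h w := f w - cseries a w.
have dh (w : C) : exists d, cderive h w d.
  by eexists; exact: (is_deriveB (derivableP (df w)) (dg w)).
have [h' dh'] := choice dh.
case: fa => r /= r0 Hr.
have rE : r = (complex.Re r)%:C by rewrite RRe_real// gtr0_real.
have r0' : 0 < complex.Re r by move: r0; rewrite ltcE/= => /andP[].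
suff: h z = 0 by move/eqP; rewrite subr_eq0 => /eqP.
apply: (entire_identity dh' r0') => w wr.
have fw : (series (fun k => (a k)%:C * w ^+ k) : (C^o)^nat) @ \oo --> (f w : C^o).
  by apply: Hr; rewrite /= sub0r normrN rE normr_normc ltcR.
have [g1 g2] := cseries_cvg w ea.
have f12 : ccvg (fun n => \sum_(0 <= k < n) (a k)%:C * w ^+ k) (f w).
  split; apply/cvgrPdist_le => e e0; have e0' : 0 < e%:C by rewrite ltcR.
  - have /cvgrPdist_le /(_ _ e0') := fw; apply: filterS => n.
    rewrite normr_normc lecR; apply: le_trans; rewrite -raddfB.
    exact: ler_Re_normc.
  - have /cvgrPdist_le /(_ _ e0') := fw; apply: filterS => n.
    rewrite normr_normc lecR; apply: le_trans; rewrite -raddfB.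
    exact: ler_Im_normc.
case: f12 => f1 f2; apply/eqP; rewrite subr_eq0 eq_complex.
by rewrite -(cvg_unique _ f1 g1)// -(cvg_unique _ f2 g2)// !eqxx.
Qed.

End ComplexSeries.

(** * The Fueter-Sce operators on power series *)

Section IteratedOperators.
Variable R : realType.
Local Notation C := R[i].
Implicit Types (a b c e : nat -> R) (g : R -> R) (x y t : R).

Definition re_ipow j : R := complex.Re ('i ^+ j : C).
Definition im_ipow j : R := complex.Im ('i ^+ j : C).

Lemma normc_ipow j : normc ('i ^+ j : C) = 1.
Proof. by rewrite normcX [normc 'i](_ : _ = 1) ?expr1n//= expr0n expr1n add0r sqrtr1. Qed.

Lemma re_ipow_le1 j : `|re_ipow j| <= 1.
Proof. by rewrite -(normc_ipow j) ler_Re_normc. Qed.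

Lemma im_ipow_le1 j : `|im_ipow j| <= 1.
Proof. by rewrite -(normc_ipow j) ler_Im_normc. Qed.

Lemma re_ipowS j : re_ipow j.+1 = - im_ipow j.
Proof. by rewrite /re_ipow exprSr ReiNIm. Qed.

Lemma im_ipowS j : im_ipow j.+1 = re_ipow j.
Proof. by rewrite /im_ipow exprSr ImiRe. Qed.

Lemma re_ipow0 : re_ipow 0 = 1. Proof. by rewrite /re_ipow expr0. Qed.
Lemma im_ipow0 : im_ipow 0 = 0. Proof. by rewrite /im_ipow expr0. Qed.

Lemma ipow_parity j : if odd j then re_ipow j = 0 else im_ipow j = 0.
Proof.
elim: j => [|j]; first by rewrite im_ipow0.
by rewrite /= re_ipowS im_ipowS; case: (odd j) => //= ->; rewrite oppr0.
Qed.

Lemma re_ipow_odd j : odd j -> re_ipow j = 0.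
Proof. by move=> jo; have := ipow_parity j; rewrite jo. Qed.

Lemma im_ipow_even j : ~~ odd j -> im_ipow j = 0.
Proof. by move=> /negbTE jo; have := ipow_parity j; rewrite jo. Qed.

Lemma ipow_shift j m : re_ipow (j + m.*2) = (-1) ^+ m * re_ipow j /\
  im_ipow (j + m.*2) = (-1) ^+ m * im_ipow j.
Proof.
elim: m => [|m [IH1 IH2]]; first by rewrite addn0 !mul1r.
by rewrite doubleS !addnS !re_ipowS !im_ipowS re_ipowS IH1 IH2 exprS !mulN1r !mulNr.
Qed.

Lemma complex_power_expand x y k :
  complex.Re ((x +i* y) ^+ k) = \sum_(0 <= j < k.+1) 'C(k, j)%:R * re_ipow j * x ^+ (k - j) * y ^+ j /\
  complex.Im ((x +i* y) ^+ k) = \sum_(0 <= j < k.+1) 'C(k, j)%:R * im_ipow j * x ^+ (k - j) * y ^+ j.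
Proof.
have -> : x +i* y = x%:C + 'i * y%:C by rewrite [LHS]complexE.
have E : (x%:C + 'i * y%:C) ^+ k = \sum_(0 <= j < k.+1)
    ('C(k, j)%:R * x ^+ (k - j) * y ^+ j)%:C * 'i ^+ j.
  rewrite exprDn big_mkord; apply: eq_bigr => j _.
  by rewrite exprMn -mulr_natl !rmorphM !rmorphXn rmorph_nat/=; ring.
rewrite E; elim: k.+1 {E} => [|n [IH1 IH2]]; first by rewrite !big_geq.
rewrite !big_nat_recr//= !raddfD/= IH1 IH2.
rewrite [in re_ipow n]/re_ipow /im_ipow.
by case: ('i ^+ n) => p q /=; split; congr (_ + _); ring.
Qed.

Lemma cseries_line a x y : entire_coef a ->
  complex.Re (cseries a (x +i* y)) = limn (pseries (fun j => re_ipow j * taylor_coef a x j) y) /\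
  complex.Im (cseries a (x +i* y)) = limn (pseries (fun j => im_ipow j * taylor_coef a x j) y).
Proof.
move=> ea; split; apply: cvg_lim => //.
- rewrite (_ : series _ = (fun K => \sum_(0 <= k < K) a k *
     \sum_(0 <= j < k.+1) 'C(k, j)%:R * re_ipow j * x ^+ (k - j) * y ^+ j)).
    by apply: binomial_rearrangement => //; exact: re_ipow_le1.
  apply/funext => n; rewrite /series/=; apply: eq_bigr => k _.
  by case: (complex_power_expand x y k) => ->.
- rewrite (_ : series _ = (fun K => \sum_(0 <= k < K) a k *
     \sum_(0 <= j < k.+1) 'C(k, j)%:R * im_ipow j * x ^+ (k - j) * y ^+ j)).
    by apply: binomial_rearrangement => //; exact: im_ipow_le1.
  apply/funext => n; rewrite /series/=; apply: eq_bigr => k _.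
  by case: (complex_power_expand x y k) => _ ->.
Qed.

Lemma pseries_recl e t : entire_coef e -> e 0%N = 0 ->
  limn (pseries e t) = t * limn (pseries (fun j => e j.+1) t).
Proof.
move=> ee e0; apply: cvg_lim => //; rewrite -cvg_shiftS.
rewrite (_ : (fun n => _) = (fun n => t * pseries (fun j => e j.+1) t n)).
  by apply: cvgMl_tmp; apply: entire_coef_pseries_cvg; exact: entire_coef_shift.
apply/funext => n; rewrite /pseries /series/= big_nat_recl// e0 mul0r add0r mulr_sumr.
by apply: eq_bigr => k _; rewrite exprS mulrCA.
Qed.

(* [step_weight m j] is the factor picked up by the coefficient of index j + 2m when
   m steps of (1/t) d/dt (j even) or of d/dt (1/t) (j odd) bring it to index j. *)
Definition step_weight m j : nat :=
  (\prod_(i < m) (j + i.*2 + (if odd j then 1 else 2)))%N.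

Lemma step_weightS m j :
  step_weight m.+1 j = ((j + if odd j then 1 else 2) * step_weight m j.+2)%N.
Proof.
rewrite /step_weight big_ord_recl/= addn0; congr (_ * _)%N.
by apply: eq_bigr => i _; rewrite negbK doubleS !addSn !addnS.
Qed.

Lemma derive1_pseries_near g e t : entire_coef e -> t != 0 ->
  (forall s, s != 0 -> g s = limn (pseries e s)) ->
  derive1 g t = limn (pseries (pseries_diffs e) t).
Proof.
move=> ee t0 gE; have dp := is_derive_pseries t ee.
have [] : is_derive t 1 g (limn (pseries (pseries_diffs e) t)); last first.
  by move=> _ <-; rewrite derive1E.
apply: near_eq_is_derive dp; near=> s; rewrite gE//.
near: s; exists `|t|; rewrite /= ?normr_gt0// => s /=.
by apply: contraTneq => ->; rewrite subr0 ltxx.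
Unshelve. all: by end_near. Qed.

(** A series of even powers has a derivative without constant term, so dividing it by $t$ is a shift
    of coefficients and leaves again even powers. Identities are needed only for $s\ne0$, since
    differentiating at $t\neq 0$ is local. *)
Lemma iter_inv_derive g e : entire_coef e -> (forall j, odd j -> e j = 0) ->
  (forall s, s != 0 -> g s = limn (pseries e s)) -> forall m,
  entire_coef (fun j => (step_weight m j)%:R * e (j + m.*2)%N) /\
  forall t, t != 0 -> iter m (fun (g : R -> R) t => t^-1 * derive1 g t) g t =
    limn (pseries (fun j => (step_weight m j)%:R * e (j + m.*2)%N) t).
Proof.
move=> ee eo gE; elim=> [|m [IH1 IH2]].
  rewrite (_ : (fun j => _) = e)//; apply/funext => j.
  by rewrite /step_weight big_ord0 mul1r addn0.
have E : (fun j => (step_weight m.+1 j)%:R * e (j + m.+1.*2)%N) =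
    (fun j => pseries_diffs (fun j => (step_weight m j)%:R * e (j + m.*2)%N) j.+1).
  apply/funext => j; rewrite /pseries_diffs step_weightS doubleS !addnS !addSn.
  (* For odd $j$ both sides vanish with [e]; there [step_weight] counts the factors of the other
     operator. *)
  have [jo|_] := boolP (odd j); last by rewrite addn2 natrM mulrA.
  by rewrite eo ?mulr0//= !negbK oddD odd_double addbF.
rewrite E; split; first exact/entire_coef_shift/entire_coef_diffs.
move=> t t0; rewrite iterS (derive1_pseries_near IH1 t0 IH2).
rewrite (pseries_recl t (entire_coef_diffs IH1)); last first.
  by rewrite /pseries_diffs eo ?mulr0//= oddD odd_double.
by rewrite mulKf.
Qed.

Lemma iter_derive_inv g e : entire_coef e -> (forall j, ~~ odd j -> e j = 0) ->
  (forall s, s != 0 -> g s = limn (pseries e s)) -> forall m,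
  entire_coef (fun j => (step_weight m j)%:R * e (j + m.*2)%N) /\
  forall t, t != 0 -> iter m (fun (g : R -> R) => derive1 (fun t => t^-1 * g t)) g t =
    limn (pseries (fun j => (step_weight m j)%:R * e (j + m.*2)%N) t).
Proof.
move=> ee eo gE; elim=> [|m [IH1 IH2]].
  rewrite (_ : (fun j => _) = e)//; apply/funext => j.
  by rewrite /step_weight big_ord0 mul1r addn0.
have E : (fun j => (step_weight m.+1 j)%:R * e (j + m.+1.*2)%N) =
    pseries_diffs (fun j => (step_weight m j.+1)%:R * e (j.+1 + m.*2)%N).
  apply/funext => j; rewrite /pseries_diffs step_weightS doubleS !addnS !addSn.
  have [_|jo] := boolP (odd j); first by rewrite addn1 natrM mulrA.
  by rewrite eo ?mulr0//= !negbK oddD odd_double addbF.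
have IH1' := entire_coef_shift IH1.
rewrite E; split; first exact/entire_coef_diffs.
move=> t t0; rewrite iterS; apply: derive1_pseries_near => // s s0.
rewrite IH2// (pseries_recl s IH1) ?mulKf//.
by rewrite eo ?mulr0//= oddD odd_double.
Qed.

(* The Dirac operator of R^n, n = 2m + 1, sends X^j to - beta_j X^(j-1). *)
Definition appell_beta m j : nat := (if odd j then j + m.*2 else j)%N.

Definition appell_den m j : nat := (\prod_(i < j) appell_beta m i.+1)%N.

Lemma appell_den_gt0 m j : (0 < appell_den m j)%N.
Proof. by apply: prodn_gt0 => i; rewrite /appell_beta; case: odd. Qed.

Lemma appell_denS m j : appell_den m j.+1 = (appell_den m j * appell_beta m j.+1)%N.
Proof. by rewrite /appell_den big_ord_recr. Qed.

Lemma fact_le_appell_den m j : (j`! <= appell_den m j)%N.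
Proof.
elim: j => [|j IH]; first by rewrite /appell_den big_ord0.
rewrite factS mulnC appell_denS leq_mul//.
by rewrite /appell_beta; case: ifP => // _; exact: leq_addr.
Qed.

(** For odd $j$ both products run over $m$ consecutive even numbers, starting at $j+3$ and at $j+1$
    respectively. They differ only in the end factors $j+1$ and $j+1+2m$. *)
Lemma step_weight_skip m j : odd j ->
  (j.+1 * step_weight m j.+1 = step_weight m j * (j.+1 + m.*2))%N.
Proof.
move=> jo; elim: m j jo => [|m IH] j jo.
  by rewrite /step_weight !big_ord0 mul1n muln1 addn0.
rewrite !step_weightS /= jo/= addn1 -mulnA addn2 IH /=; last by rewrite negbK.
by rewrite doubleS !addnS !addSn mulnCA mulnA.
Qed.

(** This is where the two transformations meet. From $j$ to $j+1$ the left side gains $j+1+2m$ in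
    either parity: for even $j$ the weight is unchanged and $\beta_{j+1}=j+1+2m$; for odd $j$ the
    weight gains $(j+1+2m)/(j+1)$ and $\beta_{j+1}=j+1$. *)
Lemma appell_den_step_weight m j :
  (appell_den m j * step_weight m j * (m.*2)`! = step_weight m 0 * (j + m.*2)`!)%N.
Proof.
elim: j => [|j IH]; first by rewrite /appell_den big_ord0 mul1n.
rewrite addSn factS mulnCA -IH appell_denS /appell_beta /=.
have [jo|je] := boolP (odd j) => /=.
  rewrite -!mulnA [(j.+1 * (_ * _))%N]mulnA step_weight_skip//; ring.
rewrite (_ : step_weight m j.+1 = step_weight m j); first by rewrite addSn; ring.
rewrite /step_weight /= je (negbTE je).
by apply: eq_bigr => i _; rewrite addSn addn1 addn2.
Qed.

Definition appell_coef m j : R := j`!%:R / (appell_den m j)%:R.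

Lemma appell_coef_le1 m j : `|appell_coef m j| <= 1.
Proof.
rewrite ger0_norm ?divr_ge0// ler_pdivrMr ?ltr0n ?appell_den_gt0// mul1r ler_nat.
exact: fact_le_appell_den.
Qed.

(** The constant $\kappa$ of the overview. As [step_weight m 0] is $2^m m!$, it equals
    $(-1)^m/(2m-1)!!=(-1)^m/(n-2)!!$. *)
Definition fueter_const m : R := (-1) ^+ m * (step_weight m 0)%:R / (m.*2)`!%:R.

Lemma fueter_const_neq0 m : fueter_const m != 0.
Proof.
rewrite !mulf_neq0// ?signr_eq0// ?invr_eq0 ?pnatr_eq0 -?lt0n ?fact_gt0//.
by apply: prodn_gt0 => i; rewrite addn2.
Qed.

Lemma step_weight_appell m j : (step_weight m j)%:R * (-1) ^+ m =
  fueter_const m * (appell_coef m j * ((j + m.*2)`!%:R / j`!%:R)).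
Proof.
have := congr1 (fun k => k%:R : R) (appell_den_step_weight m j).
have f1 k : (k`!%:R : R) != 0 by rewrite pnatr_eq0 -lt0n fact_gt0.
have f2 : ((appell_den m j)%:R : R) != 0 by rewrite pnatr_eq0 -lt0n appell_den_gt0.
rewrite !natrM /fueter_const /appell_coef => H.
apply: (mulfI f2); apply: (mulIf (f1 m.*2)).
transitivity ((step_weight m 0)%:R * (j + m.*2)`!%:R * (-1) ^+ m : R).
  by rewrite -H; ring.
field.
by rewrite f2 !f1.
Qed.

Lemma limn_pseriesZ (k : R) e t : entire_coef e ->
  limn (pseries (fun j => k * e j) t) = k * limn (pseries e t).
Proof.
move=> ee; apply: cvg_lim => //.
rewrite (_ : pseries _ t = fun n => k * pseries e t n).
  by apply: cvgMl_tmp; exact: entire_coef_pseries_cvg.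
apply/funext => n; rewrite /pseries /series/= mulr_sumr.
by apply: eq_bigr => j _; rewrite mulrA.
Qed.

(* The coefficients of the [2m]-th derivative. *)
Definition deriv2_coef m a k : R := (k + m.*2)`!%:R / k`!%:R * a (k + m.*2)%N.

Lemma entire_deriv2_coef m a : entire_coef a -> entire_coef (deriv2_coef m a).
Proof.
have E n : (fun k => (k + n)`!%:R / k`!%:R * a (k + n)%N) = iter n (@pseries_diffs R) a.
  elim: n => [|n IH]; apply/funext => k.
    by rewrite addn0 divff ?mul1r// pnatr_eq0 -lt0n fact_gt0.
  rewrite iterS -IH /pseries_diffs addnS addSn factS natrM [k.+1`!]factS natrM.
  have p0 : (k.+1%:R : R) != 0 by rewrite pnatr_eq0.
  have q0 : (k`!%:R : R) != 0 by rewrite pnatr_eq0 -lt0n fact_gt0.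
  by move: p0 q0; move: (k.+1%:R : R) (k`!%:R : R) => p q p0 q0; field; rewrite p0 q0.
move=> ea; rewrite /deriv2_coef E; elim: m.*2 => //= n.
exact: entire_coef_diffs.
Qed.

(** With [sg] equal to [re_ipow] or [im_ipow], this is the scalar or the vector part of the Appell
    series, as a function of $x_0=x$ and $t=|\mathbf x|$. *)
Definition axial_sum m (sg : nat -> R) a x t : R :=
  limn (pseries (fun j => sg j * appell_coef m j * taylor_coef a x j) t).

(** Shifting the index by $2m$ produces $(-1)^m$ from the power of $\mathrm i$ and a step weight. By
    [step_weight_appell] these combine into $\kappa c_j(j+2m)!/j!$, and the factorial ratio is
    absorbed into the Taylor coefficient of the $2m$-th derivative. *)
Lemma fueter_parts m a x (f : C -> C) : entire_coef a -> (forall z, f z = cseries a z) ->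
  forall t, t != 0 ->
  iter m (fun (g : R -> R) t => t^-1 * derive1 g t) (fun y => complex.Re (f (x +i* y))) t =
    fueter_const m * axial_sum m re_ipow (deriv2_coef m a) x t /\
  iter m (fun (g : R -> R) => derive1 (fun t => t^-1 * g t)) (fun y => complex.Im (f (x +i* y))) t =
    fueter_const m * axial_sum m im_ipow (deriv2_coef m a) x t.
Proof.
move=> ea fE t t0.
have et := entire_taylor_coef x ea.
have ed := entire_deriv2_coef m ea.
have key (sg : nat -> R) : (forall j, `|sg j| <= 1) ->
    (forall j, sg (j + m.*2)%N = (-1) ^+ m * sg j) ->
    limn (pseries (fun j => (step_weight m j)%:R * (sg (j + m.*2)%N * taylor_coef a x (j + m.*2))) t) =
    fueter_const m * axial_sum m sg (deriv2_coef m a) x t.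
  move=> sg1 sgs; rewrite -limn_pseriesZ; last first.
    apply: (@entire_coef_bounded_mul _ _ _ 1); first exact: entire_taylor_coef.
    move=> j; rewrite normrM -[1]mulr1 ler_pM// ?sg1//; exact: appell_coef_le1.
  congr (limn (pseries _ t)); apply/funext => j.
  rewrite taylor_coef_shift// sgs.
  transitivity ((step_weight m j)%:R * (-1) ^+ m * (sg j * taylor_coef a x (j + m.*2))).
    by ring.
  by rewrite step_weight_appell; ring.
split.
- have [|||_ ->//] := @iter_inv_derive (fun y => complex.Re (f (x +i* y)))
    (fun j => re_ipow j * taylor_coef a x j) _ _ _ m.
  + by apply: (@entire_coef_bounded_mul _ _ _ 1) => //; exact: re_ipow_le1.
  + by move=> j jo; rewrite re_ipow_odd// mul0r.
  + by move=> s _; rewrite fE; case: (cseries_line x s ea).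
  by apply: (key re_ipow); [exact: re_ipow_le1|move=> j; case: (ipow_shift j m)].
- have [|||_ ->//] := @iter_derive_inv (fun y => complex.Im (f (x +i* y)))
    (fun j => im_ipow j * taylor_coef a x j) _ _ _ m.
  + by apply: (@entire_coef_bounded_mul _ _ _ 1) => //; exact: im_ipow_le1.
  + by move=> j jo; rewrite im_ipow_even// mul0r.
  + by move=> s _; rewrite fE; case: (cseries_line x s ea).
  by apply: (key im_ipow); [exact: im_ipow_le1|move=> j; case: (ipow_shift j m)].
Qed.

End IteratedOperators.

(** * Appell polynomials *)

Section Derivatives.
Variable R : realType.

Lemma is_derive_line (V W : normedModType R) (F : V -> W) (x v : V) (d : W) :
  is_derive (0 : R) 1 (fun t : R => F (t *: v + x)) d -> is_derive x v F d.
Proof.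
move=> [dF <-]; apply: DeriveDef; first exact/derivable1P.
rewrite /derive; set g1 := (X in lim (X @ _) = _); set g2 := (X in _ = lim (X @ _)).
suff -> : g1 = g2 by []; apply/funext => h; rewrite /g1 /g2 /=.
by rewrite addr0 scale0r add0r [h%:A]mulr1.
Qed.

Lemma is_derive_scalel (V W : normedModType R) (g : V -> R) (x v : V) (dg : R) (c : W) :
  is_derive x v g dg -> is_derive x v (fun x => g x *: c) (dg *: c).
Proof.
move=> [dF <-].
have H : (fun h => h^-1 *: (g (h *: v + x) *: c - g x *: c)) @ (0 : R)^' --> 'D_v g x *: c.
  rewrite (_ : (fun h => _) = (fun h => h^-1 *: (g (h *: v + x) - g x) *: c)).
    exact: cvgZr_tmp.
  by apply/funext => h; rewrite -scalerBl scalerA.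
by apply: DeriveDef; [apply/cvg_ex; eexists; exact: H|exact/cvg_lim].
Qed.

Lemma lmod_double_inj (V : lmodType R) (u v : V) : u + u = v + v -> u = v.
Proof.
have E (w : V) : w = 2^-1 *: (w + w).
  by rewrite scalerDr -scalerDl (_ : _ + _ = 1) ?scale1r//; field.
by move=> uv; rewrite (E u) (E v) uv.
Qed.

(** The variable will be $X^2=-|\mathbf x|^2$, which takes no positive value; infinitely many roots
    remain. *)
Lemma poly_eq0_neg (p : {poly R}) : (forall s, s < 0 -> p.[s] = 0) -> p = 0.
Proof.
move=> p0; apply: (@roots_geq_poly_eq0 _ p [seq - (i.+1%:R) : R | i <- iota 0 (size p)]).
- apply/allP => _ /mapP[i _ ->]; apply/eqP; apply: p0.
  by rewrite oppr_lt0 ltr0n.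
- rewrite map_inj_uniq ?iota_uniq// => i j /oppr_inj/eqP.
  by rewrite eqr_nat eqSS => /eqP.
- by rewrite size_map size_iota.
Qed.

End Derivatives.

Section Paravectors.
Variables (R : realType) (n : nat).
Local Notation Cl := (clifford R n).
Implicit Types (x : 'rV[R]_n.+1) (p : {poly R}).

Definition pvec_sqr x : R := \sum_(i < n) x 0 (lift ord0 i) ^+ 2.

Lemma pvec_sqr_ge0 x : 0 <= pvec_sqr x.
Proof. by apply: sumr_ge0 => i _; exact: sqr_ge0. Qed.

Lemma pvec_norm_sqr x : pvec_norm x ^+ 2 = pvec_sqr x.
Proof. by rewrite sqr_sqrtr// pvec_sqr_ge0. Qed.

Lemma cl_e_sqr (i : 'I_n) : cl_e R i * cl_e R i = - 1.
Proof.
apply: (@lmod_double_inj R); rewrite cl_e_anticomm eqxx mulr1 -opprD.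
by rewrite scaler_nat mulr2n.
Qed.

Lemma mulr_pvec x : pvec x * pvec x = (- pvec_sqr x)%:A.
Proof.
have E : pvec x * pvec x = \sum_(i < n) \sum_(j < n)
    (x 0 (lift ord0 i) * x 0 (lift ord0 j)) *: (cl_e R i * cl_e R j).
  rewrite {1}/pvec mulr_suml; apply: eq_bigr => i _; rewrite mulr_sumr.
  by apply: eq_bigr => j _; rewrite -scalerAl -scalerAr scalerA.
apply: (@lmod_double_inj R).
rewrite {2}E exchange_big/= E -big_split/=.
transitivity (\sum_(i < n) (- (2 * x 0 (lift ord0 i) ^+ 2)) *: (1 : Cl)).
  apply: eq_bigr => i _; rewrite -big_split/= (bigD1 i)//= big1 ?addr0 => [|j ji].
    rewrite -scalerDr cl_e_anticomm eqxx mulr1 scalerN scalerA -scaleNr.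
    by congr (- _ *: _); ring.
  rewrite [X in _ + X *: _]mulrC -scalerDr cl_e_anticomm eq_sym (negPf ji).
  by rewrite mulr0 scale0r oppr0 scaler0.
rewrite -scaler_suml -scalerDl; congr (_ *: _).
by rewrite sumrN -mulr_sumr /pvec_sqr; ring.
Qed.

(* Homogenization of degree N of p, evaluated at (x_0, X). *)
Definition homog_eval (N : nat) p x : Cl :=
  \sum_(j < N.+1) (p`_j * x 0 ord0 ^+ (N - j)) *: pvec x ^+ j.

Lemma homog_evalD N p q x : homog_eval N (p + q) x = homog_eval N p x + homog_eval N q x.
Proof.
by rewrite /homog_eval -big_split; apply: eq_bigr => j _; rewrite coefD mulrDl scalerDl.
Qed.

Lemma homog_evalZ N c p x : homog_eval N (c *: p) x = c *: homog_eval N p x.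
Proof.
by rewrite /homog_eval scaler_sumr; apply: eq_bigr => j _; rewrite coefZ scalerA mulrA.
Qed.

(** Both $x$ and $\overline x$ lie in the commutative algebra generated by $X$, so their products
    can be followed on polynomials in one variable. *)
Lemma homog_evalM N p c x : (size p <= N.+1)%N ->
  homog_eval N.+1 (p * (1 + c *: 'X)) x =
  homog_eval N p x * ((x 0 ord0)%:A + c *: pvec x).
Proof.
move=> pN; rewrite mulrDr mulr1 -scalerAr homog_evalD homog_evalZ mulrDr; congr (_ + _).
  rewrite /homog_eval big_ord_recr/= nth_default// mul0r scale0r addr0.
  rewrite mulr_suml; apply: eq_bigr => j _.
  rewrite -scalerAr mulr1 scalerA; congr (_ *: _).
  by rewrite subSn -1?ltnS// exprS; ring.
rewrite -scalerAr; congr (_ *: _).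
rewrite /homog_eval big_ord_recl/= coefMX/= mul0r scale0r add0r mulr_suml.
apply: eq_bigr => j _; rewrite coefMX/= /bump leq0n add1n subSS exprSr.
by rewrite -scalerAl.
Qed.

Lemma size_one_plus (c : R) : (size ((1 + c *: 'X)%R : {poly R}) <= 2)%N.
Proof.
rewrite (leq_trans (size_polyD _ _))// geq_max size_poly1/=.
by rewrite (leq_trans (size_scale_leq _ _))// size_polyX.
Qed.

Lemma size_krawtchouk a b :
  (size (((1 + 1 *: 'X) ^+ a * (1 + -1 *: 'X) ^+ b)%R : {poly R}) <= (a + b).+1)%N.
Proof.
have sX (c : R) d : (size (((1 + c *: 'X) ^+ d)%R : {poly R}) <= d.+1)%N.
  rewrite (leq_trans (size_poly_exp_leq _ _))// ltnS -[leqRHS]mul1n leq_mul2r.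
  by rewrite -subn1 leq_subLR size_one_plus orbT.
rewrite (leq_trans (size_polyMleq _ _))//.
by have := leq_add (sX 1 a) (sX (-1) b); rewrite addSn addnS; case: (_ + _)%N.
Qed.

Lemma homog_eval_krawtchouk a b x :
  homog_eval (a + b) ((1 + 1 *: 'X) ^+ a * (1 + -1 *: 'X) ^+ b) x =
  para x ^+ a * para_conj x ^+ b.
Proof.
elim: b => [|b IH].
  rewrite addn0 !expr0 !mulr1; elim: a => [|a IH].
    by rewrite /homog_eval big_ord_recl big_ord0 !expr0 coefC/= mulr1 scale1r addr0.
  rewrite !exprSr homog_evalM; last by have := size_krawtchouk a 0; rewrite mulr1 addn0.
  by rewrite IH scale1r.
rewrite addnS !exprSr !mulrA homog_evalM; last exact: size_krawtchouk.
by rewrite IH scaleN1r.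
Qed.

(** $P_k$ on the hyperplane $x_0=1$, as a polynomial in $X$; homogeneity restores the powers of
    $x_0$. *)
Definition appell_gen (T : nat -> nat -> R) k : {poly R} :=
  \sum_(s < k.+1) T k s *: ((1 + 1 *: 'X) ^+ (k - s) * (1 + -1 *: 'X) ^+ s).

Lemma size_appell_gen T k : (size (appell_gen T k) <= k.+1)%N.
Proof.
rewrite /appell_gen (leq_trans (size_sum _ _ _))//; apply/bigmax_leqP => s _.
rewrite (leq_trans (size_scale_leq _ _))//.
by have := size_krawtchouk (k - s) s; rewrite subnK// -ltnS.
Qed.

Lemma appell_poly_homog T k x : appell_poly T k x = homog_eval k (appell_gen T k) x.
Proof.
rewrite /appell_poly /appell_gen.
have -> : homog_eval k (\sum_(s < k.+1) T k s *: ((1 + 1 *: 'X) ^+ (k - s) * (1 + -1 *: 'X) ^+ s)) x =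
   \sum_(s < k.+1) homog_eval k (T k s *: ((1 + 1 *: 'X) ^+ (k - s) * (1 + -1 *: 'X) ^+ s)) x.
  apply: (big_morph (fun p => homog_eval k p x)) => [p q|]; first exact: homog_evalD.
  by rewrite /homog_eval big1// => j _; rewrite coef0 mul0r scale0r.
apply: eq_bigr => s _; rewrite homog_evalZ -homog_eval_krawtchouk.
by rewrite subnK// -ltnS.
Qed.

Lemma pvecX_even x l : pvec x ^+ l.*2 = ((- pvec_sqr x) ^+ l)%:A.
Proof.
elim: l => [|l IH]; first by rewrite !expr0 scale1r.
by rewrite doubleS !exprS mulrA mulr_pvec IH -scalerAl mul1r scalerA.
Qed.

Lemma sum_parity (M : zmodType) (F : nat -> M) N :
  \sum_(0 <= j < N.*2) F j = \sum_(0 <= l < N) (F l.*2 + F l.*2.+1).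
Proof.
elim: N => [|N IH]; first by rewrite !big_geq.
by rewrite doubleS !big_nat_recr//= IH addrA.
Qed.

Definition scalar_part p k (x0 s : R) : R :=
  \sum_(0 <= l < k.+1) p`_(l.*2) * x0 ^+ (k - l.*2) * s ^+ l.
Definition vector_part p k (x0 s : R) : R :=
  \sum_(0 <= l < k.+1) p`_(l.*2.+1) * x0 ^+ (k - l.*2.+1) * s ^+ l.

Lemma homog_eval_parts p k x : (size p <= k.+1)%N ->
  homog_eval k p x = (scalar_part p k (x 0 ord0) (- pvec_sqr x))%:A +
    vector_part p k (x 0 ord0) (- pvec_sqr x) *: pvec x.
Proof.
move=> pk; rewrite /homog_eval.
transitivity (\sum_(0 <= j < k.+1.*2) (p`_j * x 0 ord0 ^+ (k - j)) *: pvec x ^+ j).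
  rewrite (@big_cat_nat _ _ _ k.+1 0 k.+1.*2)//=; last by rewrite -addnn leq_addr.
  rewrite big_mkord [X in _ = _ + X](_ : _ = 0) ?addr0// big_nat_cond big1// => j.
  by move=> /andP[/andP[kj _] _]; rewrite nth_default ?(leq_trans pk)// mul0r scale0r.
rewrite sum_parity big_split/= !scaler_suml; congr (_ + _); apply: eq_bigr => l _.
  by rewrite pvecX_even scalerA.
by rewrite exprS pvecX_even -scalerAr mulr1 !scalerA.
Qed.


Lemma sum_poly_horner (c : nat -> R) N s :
  \sum_(0 <= l < N) c l * s ^+ l = (\poly_(l < N) c l).[s].
Proof. by rewrite horner_poly big_mkord. Qed.

Lemma pvecD (t : R) (v x : 'rV[R]_n.+1) : pvec (t *: v + x) = t *: pvec v + pvec x.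
Proof.
rewrite /pvec scaler_sumr -big_split; apply: eq_bigr => i _.
by rewrite !mxE scalerDl scalerA.
Qed.

Lemma pvec_delta0 : pvec (delta_mx 0 ord0 : 'rV[R]_n.+1) = 0.
Proof. by rewrite /pvec big1// => i _; rewrite mxE eqxx scale0r. Qed.

Lemma pvec_axis (t : R) : pvec (t *: delta_mx 0 ord0 : 'rV[R]_n.+1) = 0.
Proof.
rewrite -[t *: _]addr0 pvecD pvec_delta0 scaler0 add0r /pvec big1// => i _.
by rewrite mxE scale0r.
Qed.

Lemma pvec_delta_lift (i : 'I_n) : pvec (delta_mx 0 (lift ord0 i) : 'rV[R]_n.+1) = cl_e R i.
Proof.
rewrite /pvec (bigD1 i)//= big1 ?addr0 => [|j ji].
  by rewrite mxE !eqxx scale1r.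
by rewrite mxE eqxx/= (inj_eq (@lift_inj _ ord0)) (negPf ji) scale0r.
Qed.

Lemma pvec_sqrD_delta0 (t : R) x : pvec_sqr (t *: delta_mx 0 ord0 + x) = pvec_sqr x.
Proof. by apply: eq_bigr => i _; rewrite !mxE eqxx/= mulr0 add0r. Qed.

Lemma pvec_sqrD_delta_lift (t : R) (i : 'I_n) x :
  pvec_sqr (t *: delta_mx 0 (lift ord0 i) + x) =
  pvec_sqr x + 2 * x 0 (lift ord0 i) * t + t ^+ 2.
Proof.
rewrite /pvec_sqr (bigD1 i)//= [in RHS](bigD1 i)//= !mxE !eqxx mulr1.
rewrite [X in _ + X = _](_ : _ = \sum_(j < n | j != i) x 0 (lift ord0 j) ^+ 2); first by ring.
apply: eq_bigr => j ji.
by rewrite !mxE eqxx/= (inj_eq (@lift_inj _ ord0)) (negPf ji) mulr0 add0r.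
Qed.

Lemma is_derive_exprn1 (N : nat) : is_derive (0 : R) 1 (fun t : R => (t + 1) ^+ N) N%:R.
Proof.
have d1 : is_derive (0 + 1 : R) 1 (@GRing.exp R ^~ N) N%:R.
  apply: DeriveDef; first exact: exprn_derivable.
  by rewrite exp_derive add0r expr1n /GRing.scale/= !mulr1.
have d2 : is_derive (0 : R) 1 (fun t : R => t + 1) 1.
  exact: is_derive_shift.
by apply: (is_derive_eq (@is_derive1_comp _ _ (fun t : R => t + 1) 0 _ _ d1 d2)); rewrite mulr1.
Qed.

Lemma is_derive_part (c : nat -> R) (d : nat -> nat) s N :
  is_derive (0 : R) 1 (fun t : R => \sum_(0 <= l < N) c l * (t + 1) ^+ (d l) * s ^+ l)
    (\poly_(l < N) (c l * (d l)%:R)).[s].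
Proof.
rewrite -sum_poly_horner; elim: N => [|N IH].
  rewrite big_geq// (_ : (fun _ => _) = cst 0); first exact: is_derive_cst.
  by apply/funext => t; rewrite big_geq.
rewrite big_nat_recr//= (_ : (fun t => _) = (fun t : R =>
    \sum_(0 <= l < N) c l * (t + 1) ^+ (d l) * s ^+ l) +
    ((c N * s ^+ N) \*: (fun t : R => (t + 1) ^+ (d N)))); last first.
  by apply/funext => t; rewrite big_nat_recr//=; congr (_ + _); exact: mulrAC.
apply: is_deriveD; apply: (is_derive_eq (@is_deriveZ _ _ _ _ (c N * s ^+ N) _ _ _ (is_derive_exprn1 (d N)))).
by rewrite /GRing.scale/=; ring.
Qed.

(** On $x_0=1$ the function is $\alpha(s)+\beta(s)X$ with $s=X^2$, and $\partial s/\partial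
    x_i=-2x_i$. The sums over $i$ collapse through $\sum e_ix_i=X$, $\sum x_ie_iX=s$ and $\sum
    e_ie_i=-n$, the last being the only entry of the dimension. *)
Lemma homog_eval_cauchy_riemann p k x : (size p <= k.+1)%N -> x 0 ord0 = 1 ->
  let s := - pvec_sqr x in
  let alpha : {poly R} := \poly_(l < k.+1) p`_(l.*2) in
  let beta : {poly R} := \poly_(l < k.+1) p`_(l.*2.+1) in
  let alpha0 : {poly R} := \poly_(l < k.+1) (p`_(l.*2) * (k - l.*2)%:R) in
  let beta0 : {poly R} := \poly_(l < k.+1) (p`_(l.*2.+1) * (k - l.*2.+1)%:R) in
  cauchy_riemann (homog_eval k p) x =
    (alpha0 - 2 *: ('X * beta^`()) - n%:R *: beta).[s]%:A +
    (beta0 - 2 *: alpha^`()).[s] *: pvec x.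
Proof.
move=> pk x1 s alpha beta alpha0 beta0.
have FE y : homog_eval k p y = (scalar_part p k (y 0 ord0) (- pvec_sqr y))%:A +
    vector_part p k (y 0 ord0) (- pvec_sqr y) *: pvec y.
  exact: homog_eval_parts.
have D0 : is_derive x (delta_mx 0 ord0) (homog_eval k p) (alpha0.[s]%:A + beta0.[s] *: pvec x).
  apply: is_derive_line.
  rewrite (_ : (fun t => _) = (fun t : R => scalar_part p k (t + 1) s *: (1 : Cl) +
      vector_part p k (t + 1) s *: pvec x)); last first.
    apply/funext => t; rewrite FE pvecD pvec_delta0 scaler0 add0r pvec_sqrD_delta0.
    by rewrite !mxE !eqxx mulr1 x1.
  apply: is_deriveD; apply: is_derive_scalel.
    exact: is_derive_part.
  exact: is_derive_part.
pose ci i := - 2 * x 0 (lift ord0 i).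
have Di i : is_derive x (delta_mx 0 (lift ord0 i)) (homog_eval k p)
   ((alpha^`().[s] * ci i)%:A +
    (beta^`().[s] * ci i) *: pvec x + beta.[s] *: cl_e R i).
  apply: is_derive_line.
  (* The value of $X^2$ after moving by $t$ along $e_i$. *)
  pose sg (t : R) := s + ci i * t - t ^+ 2.
  have sg0 : sg 0 = s by rewrite /sg mulr0 expr0n subr0 addr0.
  rewrite (_ : (fun t => _) = (fun t : R => alpha.[sg t] *: (1 : Cl) +
      beta.[sg t] *: pvec x + (beta.[sg t] * t) *: cl_e R i)); last first.
    apply/funext => t; rewrite FE pvecD pvec_delta_lift pvec_sqrD_delta_lift.
    rewrite !mxE eqxx/= mulr0 add0r x1 -!sum_poly_horner.
    rewrite [- _](_ : _ = sg t); last by rewrite /sg /s /ci; ring.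
    rewrite -addrA -scalerA -scalerDr [t *: _ + _]addrC; congr (_ *: _ + _ *: _).
      by apply: eq_bigr => l _; rewrite expr1n mulr1.
    by apply: eq_bigr => l _; rewrite expr1n mulr1.
  have dsg : is_derive (0 : R) 1 sg (ci i).
    have d1 := @is_deriveZ _ _ _ id (ci i) (0 : R) 1 1 (is_derive_id _ _).
    have d2 := @is_deriveX _ _ _ 2 (0 : R) 1 1 (is_derive_id _ _).
    apply: (is_derive_eq (is_deriveB (is_deriveD (is_derive_cst s _ _) d1) d2)).
    by rewrite /GRing.scale/= expr1 !mulr0 mulr1 mul0r; ring.
  have dh (q : {poly R}) : is_derive (0 : R) 1 (fun t => q.[sg t]) (q^`().[s] * ci i).
    have dq : is_derive (sg 0) 1 (horner q) q^`().[s] by rewrite sg0; exact: is_derive_poly.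
    exact: (@is_derive1_comp _ _ sg 0 _ _ dq dsg).
  apply: is_deriveD; first by apply: is_deriveD; apply: is_derive_scalel; exact: dh.
  apply: is_derive_scalel.
  have := @is_deriveM _ _ _ _ _ _ _ _ (dh beta) (is_derive_id (0 : R) 1).
  rewrite /GRing.scale/= sg0 mulr1 mul0r addr0; exact.
rewrite /cauchy_riemann; have [_ ->] := D0.
have S1 (c : R) : \sum_(i < n) cl_e R i * ((c * ci i)%:A) = (-2 * c) *: pvec x.
  rewrite /pvec scaler_sumr; apply: eq_bigr => i _.
  by rewrite -scalerAr mulr1 scalerA; congr (_ *: _); rewrite /ci; ring.
have S2 (c : R) : \sum_(i < n) cl_e R i * ((c * ci i) *: pvec x) = (-2 * c * s)%:A.
  rewrite -scalerA -mulr_pvec {2}/pvec mulr_suml scaler_sumr; apply: eq_bigr => i _.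
  by rewrite -scalerAr -scalerAl scalerA; congr (_ *: _); rewrite /ci; ring.
have S3 (c : R) : \sum_(i < n) cl_e R i * (c *: cl_e R i) = (- (n%:R * c))%:A.
  transitivity (\sum_(i < n) ((- c) *: (1 : Cl))).
    by apply: eq_bigr => i _; rewrite -scalerAr cl_e_sqr scalerN scaleNr.
  by rewrite sumr_const card_ord -scaler_nat scalerA mulrN.
rewrite (eq_bigr (fun i => cl_e R i * ((alpha^`().[s] * ci i)%:A) +
   cl_e R i * ((beta^`().[s] * ci i) *: pvec x) + cl_e R i * (beta.[s] *: cl_e R i))); last first.
  by move=> i _; have [_ ->] := Di i; rewrite !mulrDr.
rewrite !big_split S1 S2 S3.
have AC5 (M : zmodType) (a b c d e : M) : a + b + (c + d + e) = a + d + e + (b + c).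
  by rewrite -!addrA; congr (a + _); rewrite addrA addrC -addrA.
rewrite AC5 -!scalerDl; congr (_ *: _ + _ *: _); rewrite !hornerE /=; ring.
Qed.

(** Every $s<0$ equals $X^2$ for some multiple $X$ of a generator. The scalar and vector parts of
    the Cauchy-Riemann equation then vanish for all negative $s$, hence as polynomials, and their
    coefficients are compared. *)
Lemma homog_eval_monogenic_coef p k : (0 < n)%N -> (size p <= k.+1)%N ->
  (forall x, cauchy_riemann (homog_eval k p) x = 0) -> forall l,
  p`_(l.*2) * (k - l.*2)%:R = (l.*2 + n)%:R * p`_(l.*2.+1) /\
  p`_(l.*2.+1) * (k - l.*2.+1)%:R = l.+1.*2%:R * p`_(l.+1.*2).
Proof.
move=> n0 pk CR l.
have p0 j : (k < j)%N -> p`_j = 0 by move=> kj; rewrite nth_default// (leq_trans pk).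
pose alpha : {poly R} := \poly_(l < k.+1) p`_(l.*2).
pose beta : {poly R} := \poly_(l < k.+1) p`_(l.*2.+1).
pose alpha0 : {poly R} := \poly_(l < k.+1) (p`_(l.*2) * (k - l.*2)%:R).
pose beta0 : {poly R} := \poly_(l < k.+1) (p`_(l.*2.+1) * (k - l.*2.+1)%:R).
have dbl j : (j <= k)%N = false -> (k < j.*2)%N.
  by move=> /negbT; rewrite -ltnNge => /leq_trans; apply; rewrite -addnn leq_addr.
have ca j : alpha`_j = p`_(j.*2).
  by rewrite coef_poly ltnS; case: ifPn => // /negbTE /dbl /p0 ->.
have cb j : beta`_j = p`_(j.*2.+1).
  rewrite coef_poly ltnS; case: ifPn => // /negbTE /dbl h.
  by rewrite p0// ltnW.
have ca0 j : alpha0`_j = p`_(j.*2) * (k - j.*2)%:R.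
  by rewrite coef_poly ltnS; case: ifPn => // /negbTE /dbl /p0 ->; rewrite mul0r.
have cb0 j : beta0`_j = p`_(j.*2.+1) * (k - j.*2.+1)%:R.
  rewrite coef_poly ltnS; case: ifPn => // /negbTE /dbl h.
  by rewrite p0 ?mul0r// ltnW.
have key s : s < 0 -> (alpha0 - 2 *: ('X * beta^`()) - n%:R *: beta).[s] = 0 /\
   (beta0 - 2 *: alpha^`()).[s] = 0.
  move=> s0; pose i0 : 'I_n := Ordinal n0.
  pose x : 'rV[R]_n.+1 := Num.sqrt (- s) *: delta_mx 0 (lift ord0 i0) + delta_mx 0 ord0.
  have x1 : x 0 ord0 = 1 by rewrite /x !mxE !eqxx/= mulr0 add0r.
  have xs : - pvec_sqr x = s.
    rewrite /x pvec_sqrD_delta_lift [pvec_sqr _](_ : _ = 0); last first.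
      by apply: big1 => i _; rewrite mxE eqxx/= expr0n.
    by rewrite mxE eqxx/= mulr0 mul0r !add0r sqr_sqrtr ?opprK// oppr_ge0 ltW.
  have := homog_eval_cauchy_riemann pk x1; rewrite CR xs /= => /esym.
  rewrite -/alpha -/beta -/alpha0 -/beta0.
  set E := (alpha0 - _ - _).[s]; set O := (beta0 - _).[s] => H.
  (* Multiplying by the conjugate separates the two parts: the product is $E^2-O^2s$, a sum of
     nonnegative terms since $s<0$. *)
  have : (E%:A + O *: pvec x) * (E%:A - O *: pvec x) = 0 by rewrite H mul0r.
  have -> : (E%:A + O *: pvec x) * (E%:A - O *: pvec x) = (E ^+ 2 - O ^+ 2 * s)%:A.
    rewrite mulrBr !mulrDl -!scalerAl -!scalerAr !mul1r mulr1 mulr_pvec xs !scalerA.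
    rewrite [E * O]mulrC opprD addrA addrK -scalerBl.
    by congr (_ *: _); ring.
  move=> /eqP; rewrite scaler_eq0 oner_eq0 orbF.
  have Es : 0 <= E ^+ 2 by exact: sqr_ge0.
  have Os : 0 <= O ^+ 2 * (- s) by rewrite mulr_ge0 ?sqr_ge0// oppr_ge0 ltW.
  rewrite -mulrN paddr_eq0// => /andP[]; rewrite sqrf_eq0 => /eqP ->.
  by rewrite mulf_eq0 oppr_eq0 (lt_eqF s0) orbF sqrf_eq0 => /eqP ->.
have H1 : alpha0 - 2 *: ('X * beta^`()) - n%:R *: beta = 0.
  by apply: poly_eq0_neg => s /key[].
have H2 : beta0 - 2 *: alpha^`() = 0 by apply: poly_eq0_neg => s /key[].
have := congr1 (fun q : {poly R} => q`_l) H1; have := congr1 (fun q : {poly R} => q`_l) H2.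
rewrite !coefB !coefZ coefXM !coef_deriv coef0 ca0 cb0 !cb ca => E2 E1; split.
  apply/eqP; rewrite -subr_eq0 -[X in _ == X]E1; apply/eqP.
  case: (l) => [|l'] /=; first by rewrite natrD; ring.
  by rewrite natrD -!mul2n !natrM -mulr_natr; ring.
apply/eqP; rewrite -subr_eq0 -[X in _ == X]E2; apply/eqP.
have -> : l.+1.*2%:R = 2 * l.+1%:R :> R by rewrite -mul2n natrM.
by rewrite -mulr_natr; ring.
Qed.

(** The two parities merge into $p_j(k-j)=\beta_{j+1}p_{j+1}$, started by $p_0=P_k(1)=1$. The
    factors $k-j$ build the binomial coefficient. *)
Lemma appell_gen_coef T m k : n = m.*2.+1 -> appell_coefs n T -> forall j, (j <= k)%N ->
  (appell_gen T k)`_j = 'C(k, j)%:R * appell_coef R m j.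
Proof.
move=> nE HT; have [[_ hol] one _] := HT k.
have FE : appell_poly T k = homog_eval k (appell_gen T k).
  by apply/funext => x; exact: appell_poly_homog.
have n0 : (0 < n)%N by rewrite nE.
have CR x : cauchy_riemann (homog_eval k (appell_gen T k)) x = 0.
  by rewrite -FE; case: (hol x I).
have rec : forall j, (appell_gen T k)`_j * (k - j)%:R =
    (appell_beta m j.+1)%:R * (appell_gen T k)`_j.+1.
  move=> j; have [H1 H2] := homog_eval_monogenic_coef n0 (size_appell_gen T k) CR j./2.
  rewrite -(odd_double_half j); case: (odd j); rewrite ?add1n ?add0n /appell_beta /= odd_double/=.
    by rewrite H2.
  by rewrite H1 nE addnS addSn.
elim=> [|j IH] jk.
  rewrite bin0 /appell_coef /appell_den big_ord0 fact0 divr1 mulr1.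
  have := one; rewrite appell_poly_homog /homog_eval big_ord_recl big1 => [|j _].
    rewrite mxE !eqxx expr1n mulr1 expr0 addr0 => /eqP.
    by rewrite -subr_eq0 -[X in _ - X]scale1r -scalerBl scaler_eq0 oner_eq0 orbF subr_eq0 => /eqP.
  by rewrite pvec_delta0 expr0n/= scaler0.
have b0 : ((appell_beta m j.+1)%:R : R) != 0.
  by rewrite pnatr_eq0 /appell_beta; case: ifP.
apply: (mulfI b0); rewrite -rec IH ?(ltnW jk)// /appell_coef appell_denS factS.
have f2 : ((appell_den m j)%:R : R) != 0 by rewrite pnatr_eq0 -lt0n appell_den_gt0.
have E : 'C(k, j.+1)%:R * j.+1%:R = 'C(k, j)%:R * (k - j)%:R :> R.
  by rewrite -!natrM mulnC mul_bin_left mulnC.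
rewrite !natrM; transitivity (('C(k, j)%:R * (k - j)%:R) * j`!%:R / (appell_den m j)%:R : R).
  by field.
by rewrite -E; field; rewrite b0.
Qed.

Lemma appell_poly_expand T m k x : n = m.*2.+1 -> appell_coefs n T ->
  appell_poly T k x = \sum_(0 <= j < k.+1)
    ('C(k, j)%:R * appell_coef R m j * x 0 ord0 ^+ (k - j)) *: pvec x ^+ j.
Proof.
move=> nE HT; rewrite appell_poly_homog /homog_eval big_mkord.
by apply: eq_bigr => j _; rewrite (appell_gen_coef nE HT)// -ltnS.
Qed.

(** $X=|\mathbf x|\,\boldsymbol\omega$ and $\boldsymbol\omega$ multiplies like $\mathrm i$. The
    formula also holds at $X=0$, where [pvec_dir] is 0. *)
Lemma pvec_expr x j : pvec x ^+ j =
  (re_ipow R j * pvec_norm x ^+ j)%:A + (im_ipow R j * pvec_norm x ^+ j) *: pvec_dir x.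
Proof.
have dirE : pvec_norm x *: pvec_dir x = pvec x.
  rewrite /pvec_dir scalerA; have [r0|r0] := eqVneq (pvec_norm x) 0; last first.
    by rewrite divff// scale1r.
  rewrite r0 mul0r scale0r; have := pvec_norm_sqr x; rewrite r0 expr0n/= => /esym s0.
  rewrite /pvec big1// => i _.
  have /eqP : x 0 (lift ord0 i) ^+ 2 = 0.
    by apply: (psumr_eq0P _ s0) => // j' _; exact: sqr_ge0.
  by rewrite sqrf_eq0 => /eqP ->; rewrite scale0r.
elim: j => [|j IH]; first by rewrite !expr0 re_ipow0 im_ipow0 mul0r scale0r addr0 mulr1 scale1r.
rewrite exprSr IH re_ipowS im_ipowS mulrDl -!scalerAl mul1r.
have -> : (pvec_norm x)^-1 *: (pvec x * pvec x) = (- pvec_norm x)%:A.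
  rewrite mulr_pvec scalerA -pvec_norm_sqr.
  have [->|r0] := eqVneq (pvec_norm x) 0; first by rewrite expr0n oppr0 mulr0.
  by congr (_ *: _); field.
rewrite -{1}dirE !scalerA addrC; congr (_ *: _ + _ *: _); rewrite exprSr; ring.
Qed.
End Paravectors.

(** * Comparison *)

Section AppellSum.
Variables (R : realType) (n m : nat).
Hypothesis n_def : n = m.*2.+1.
Local Notation Cl := (clifford R n).
Implicit Types (b : nat -> R) (x y : 'rV[R]_n.+1).

Definition appell_sum b x : Cl :=
  (axial_sum m (re_ipow R) b (x 0 ord0) (pvec_norm x))%:A +
  axial_sum m (im_ipow R) b (x 0 ord0) (pvec_norm x) *: pvec_dir x.

Let sgc_le1 (sg : nat -> R) j : (forall j, `|sg j| <= 1) -> `|sg j * appell_coef R m j| <= 1.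
Proof.
by move=> sg1; rewrite normrM -[1]mulr1 ler_pM ?sg1 ?appell_coef_le1.
Qed.

Lemma appell_ext_sums_cvg T b x : appell_coefs n T -> entire_coef b ->
  appell_ext_sums T b x @ \oo --> appell_sum b x.
Proof.
move=> HT eb.
pose S sg K := \sum_(0 <= k < K) b k * \sum_(0 <= j < k.+1)
   'C(k, j)%:R * (sg j * appell_coef R m j) * x 0 ord0 ^+ (k - j) * pvec_norm x ^+ j.
rewrite (_ : appell_ext_sums T b x = (fun K => S (re_ipow R) K *: (1 : Cl) +
    S (im_ipow R) K *: pvec_dir x)).
  apply: cvgD; apply: cvgZr_tmp; apply: binomial_rearrangement => // j; apply: sgc_le1.
    exact: re_ipow_le1.
  exact: im_ipow_le1.
apply/funext => K; rewrite /appell_ext_sums /series/= /S !scaler_suml -big_split/=.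
apply: eq_bigr => k _; rewrite (appell_poly_expand k x n_def HT).
rewrite -!scalerA -scalerDr !scaler_suml -big_split/=; congr (_ *: _).
apply: eq_bigr => j _; rewrite pvec_expr scalerDr !scalerA.
by congr (_ *: _ + _ *: _); ring.
Qed.

Lemma taylor_coef0 b (t : R) : taylor_coef b t 0 = limn (pseries b t).
Proof.
rewrite /taylor_coef /pseries; congr (limn (series _)); apply/funext => k.
by rewrite bin0 mulr1 subn0.
Qed.

(** Since $c_0=1$, the subtracted quantity is the constant term in $t$. The other terms contain $t$,
    and for $|t|\le1$ the cofactor is bounded by the Taylor sum at 1, uniformly for $|s|\le\rho$. *)
Lemma axial_sum_near_axis (sg : nat -> R) b (rho : R) : (forall j, `|sg j| <= 1) ->
  entire_coef b -> 0 <= rho ->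
  exists2 M, 0 <= M & forall s t : R, `|s| <= rho -> `|t| <= 1 ->
    `|axial_sum m sg b s t - sg 0 * limn (pseries b s)| <= `|t| * M.
Proof.
move=> sg1 eb rho0.
have [C C0 HC] := entire_coef_geometric eb (addr_ge0 rho0 (ler01 : 0 <= 1 :> R)).
exists (2 * C) => [|s t srho t1]; first by rewrite mulr_ge0.
have HC' k : `|b k| * (`|s| + `|1|) ^+ k <= geometric C 2^-1 k.
  apply: le_trans (HC k); rewrite ler_wpM2l// normr1 lerXn2r// ?nnegrE ?addr_ge0//.
  by rewrite lerD2r.
pose e j := sg j * appell_coef R m j * taylor_coef b s j.
have ce : cvgn (pseries e t).
  apply: entire_coef_pseries_cvg; apply: (@entire_coef_bounded_mul _ _ _ 1) => //.
    exact: entire_taylor_coef.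
  by move=> j; exact: sgc_le1.
have e0 : sg 0 * limn (pseries b s) = e 0%N.
  by rewrite /e /appell_coef /appell_den big_ord0 fact0 divr1 mulr1 taylor_coef0.
rewrite e0 /axial_sum -/e.
have cv : `|pseries e t K - e 0%N| @[K --> \oo] --> `|limn (pseries e t) - e 0%N|.
  by apply: cvg_norm; apply: cvgB => //; exact: cvg_cst.
rewrite -(cvg_lim (@Rhausdorff R) cv); apply: limr_le; first by apply/cvg_ex; eexists; exact: cv.
exists 1%N => // -[//|K] _ /=.
rewrite /pseries /series/= big_nat_recl// expr0 mulr1 addrAC subrr add0r.
apply: le_trans (ler_norm_sum _ _ _) _.
have := @taylor_coef_tail R b s 1 C 0 K.+1 eb C0 HC'; rewrite expr0 mulr1 => H.
apply: le_trans (ler_wpM2l (normr_ge0 t) H).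
rewrite mulr_sumr [leRHS]big_nat_recl//= ler_wpDl ?mulr_ge0 ?exprn_ge0//.
apply: ler_sum => j _; rewrite big_geq// subr0 normr1 expr1n mul1r.
rewrite normrM normrX exprS mulrCA ler_wpM2l// -[leRHS]mulr1.
apply: ler_pM; rewrite ?exprn_ge0 ?exprn_ile1//.
by rewrite /e normrM ler_piMl// sgc_le1.
Qed.

Lemma pvec_norm_eq0 x : (pvec_norm x == 0) = (pvec x == 0).
Proof.
apply/idP/idP => [/eqP r0|/eqP x0].
  have := pvec_expr x 1; rewrite expr1 /pvec_dir r0 expr1 !mulr0 scale0r add0r invr0.
  by rewrite !scale0r => ->.
have := mulr_pvec x; rewrite x0 mulr0 => /esym/eqP.
by rewrite scaler_eq0 oner_eq0 orbF oppr_eq0 -pvec_norm_sqr sqrf_eq0.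
Qed.

Lemma appell_sum_axis b x : pvec x = 0 -> appell_sum b x = (limn (pseries b (x 0 ord0)))%:A.
Proof.
move=> x0; rewrite /appell_sum /pvec_dir x0 !scaler0 addr0.
have /eqP -> : pvec_norm x == 0 by rewrite pvec_norm_eq0 x0.
rewrite /axial_sum pseries_at0 /appell_coef /appell_den big_ord0 fact0 divr1 mulr1.
by rewrite re_ipow0 mul1r taylor_coef0.
Qed.

Section AxisLimit.
Variables (F : set_system 'rV[R]_n.+1) (x : 'rV[R]_n.+1).
Context {FF : Filter F}.
Hypothesis Fx : forall j, (y : 'rV[R]_n.+1) 0 j @[y --> F] --> x 0 j.

Lemma pvec_cvg : pvec y @[y --> F] --> pvec x.
Proof.
apply: cvg_big => [|i _]; first exact: add_continuous.
by apply: cvgZr_tmp; exact: Fx.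
Qed.

Lemma pvec_norm_cvg : pvec_norm y @[y --> F] --> pvec_norm x.
Proof.
apply: (@cvg_comp _ _ _ (@pvec_sqr R n) Num.sqrt F (nbhs (pvec_sqr x))); last exact: sqrt_continuous.
apply: cvg_big => [|i _]; first exact: add_continuous.
by apply: cvgM; exact: Fx.
Qed.

(** Stated for any filter along which the coordinates converge, so as to apply to neighborhoods with
    the axis removed. *)
Lemma appell_sum_cvg_axis b : entire_coef b -> pvec x = 0 ->
  appell_sum b y @[y --> F] --> appell_sum b x.
Proof.
move=> eb x0; rewrite (appell_sum_axis b x0).
pose rho : R := `|x 0 ord0| + 1; have rho0 : 0 <= rho by rewrite addr_ge0.
have [M1 M10 H1] := axial_sum_near_axis (@re_ipow_le1 R) eb rho0.
have [M2 M20 H2] := axial_sum_near_axis (@im_ipow_le1 R) eb rho0.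
have r0 : pvec_norm x = 0 by apply/eqP; rewrite pvec_norm_eq0 x0.
have c2 : `|pvec_norm y| @[y --> F] --> (0 : R).
  by rewrite -(normr0 R) -r0; apply: cvg_norm; exact: pvec_norm_cvg.
have near1 : \near F, `|(F : 'rV[R]_n.+1) 0 ord0| <= rho.
  have c1 : `|(y : 'rV[R]_n.+1) 0 ord0| @[y --> F] --> `|x 0 ord0|.
    by apply: cvg_norm; exact: Fx.
  by apply: (cvgr_le _ c1); rewrite ltrDl.
have near2 : \near F, `|pvec_norm F| <= 1 :> R by apply: (cvgr_le _ c2).
rewrite -[X in _ --> X]addr0; apply: cvgD.
  apply: cvgZr_tmp.
  pose G (t : R) := limn (pseries b t).
  rewrite (_ : (fun y => _) = (fun y : 'rV[R]_n.+1 =>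
    (axial_sum m (re_ipow R) b (y 0 ord0) (pvec_norm y) - G (y 0 ord0)) + G (y 0 ord0))); last first.
    by apply/funext => y; rewrite subrK.
  rewrite -[X in _ --> X]add0r; apply: cvgD; last first.
    apply: (@cvg_comp _ _ _ (fun y : 'rV[R]_n.+1 => y 0 ord0) G F (nbhs (x 0 ord0))).
      exact: Fx.
    exact: (is_derive_continuous (is_derive_pseries (x 0 ord0) eb)).
  apply: norm_cvg0; apply: (squeeze_cvgr (f := cst 0) (h := fun y => `|pvec_norm y| * M1)).
  - near=> y; rewrite normr_ge0/=; have := H1 (y 0 ord0) (pvec_norm y).
    by rewrite re_ipow0 mul1r; apply; near: y.
  - exact: cvg_cst.
  - by rewrite -(mul0r M1); exact: cvgMr_tmp.
apply: norm_cvg0.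
apply: (squeeze_cvgr (f := cst 0) (h := fun y => M2 * `|pvec y|)).
(* The vector part is at most $M_2|\mathbf y|$ times $\|Y\|/|\mathbf y|$, with $Y$ the vector of $y$
   and $\|Y\|$ its library norm. The Euclidean length cancels and $M_2\|Y\|$ tends to 0. *)
- near=> y; rewrite normr_ge0/= normrZ /pvec_dir normrZ mulrA ler_wpM2r//.
  have := H2 (y 0 ord0) (pvec_norm y); rewrite im_ipow0 mul0r subr0 => H.
  have [->|rn0] := eqVneq (pvec_norm y) 0; first by rewrite invr0 normr0 mulr0.
  rewrite normfV ler_pdivrMr ?normr_gt0// mulrC; apply: H; by near: y.
- exact: cvg_cst.
- rewrite -(mulr0 M2); apply: cvgMl_tmp; rewrite -(normr0 Cl) -x0.
  by apply: cvg_norm; exact: pvec_cvg.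
Unshelve. all: by end_near. Qed.

End AxisLimit.

(** Points of the axis are limits of points off it, as there is at least one generator to move
    along; this makes the limit defining [fueter_sce] on the axis unique. *)
Lemma off_axis_proper x : ProperFilter (within [set y | pvec y != 0] (nbhs x)).
Proof.
apply: within_nbhs_proper; have [|x0] := boolP (pvec x != 0).
  by move=> xn; exact: subset_closure.
rewrite negbK in x0; have n0 : (0 < n)%N by rewrite n_def.
pose v : 'rV[R]_n.+1 := delta_mx 0 (lift ord0 (Ordinal n0)).
have c : (t *: v + x) @[t --> (0 : R)] --> x.
  rewrite -[X in _ --> X]add0r; apply: cvgD; last exact: cvg_cst.
  by rewrite -[X in _ --> X](scale0r v); apply: cvgZr_tmp; exact: cvg_id.
move=> B /c /=; rewrite nbhs_simpl/= => -[r r0 Hr].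
exists ((r / 2) *: v + x); split; last first.
  apply: Hr; rewrite /= sub0r normrN ger0_norm ?divr_ge0 ?(ltW r0)//.
  by rewrite ltr_pdivrMr// ltr_pMr// ltr1n.
rewrite /= pvecD (eqP x0) addr0 pvec_delta_lift scaler_eq0 mulf_eq0 gt_eqF//= invr_eq0 pnatr_eq0/=.
by apply/eqP => e0; have := cl_e_sqr R (Ordinal n0); rewrite e0 mul0r => /eqP; rewrite eq_sym oppr_eq0 oner_eq0.
Qed.

Lemma fueter_sce_eq (f : R[i] -> R[i]) alpha (a : nat -> R) x :
  entire_coef a -> (forall z, f z = cseries a z) ->
  fueter_sce f alpha x = (alpha * fueter_const R m) *: appell_sum (deriv2_coef m a) x.
Proof.
move=> ea fE; have ed := entire_deriv2_coef m ea.
have off y : pvec y != 0 -> fueter_sce_off_axis f alpha y =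
    (alpha * fueter_const R m) *: appell_sum (deriv2_coef m a) y.
  rewrite -pvec_norm_eq0 => r0.
  have [E1 E2] := fueter_parts m (y 0 ord0) ea fE r0.
  have mE : (n.-1)./2 = m by rewrite n_def /= doubleK.
  rewrite /fueter_sce_off_axis mE /re_part /im_part E1 E2 /appell_sum.
  by rewrite !scalerDr !scalerA !mulrA.
rewrite /fueter_sce; case: ifPn => [/eqP x0|]; last exact: off.
have FP := off_axis_proper x.
apply: cvg_lim; first exact: norm_hausdorff.
apply: (@cvg_trans _ ((alpha * fueter_const R m) *: appell_sum (deriv2_coef m a) y
    @[y --> within [set y | pvec y != 0] (nbhs x)])).
  by apply: fmap_within_eq => y; rewrite inE => /off.
apply: cvgZl_tmp; apply: appell_sum_cvg_axis => // j.
apply: cvg_within_filter; exact: coord_continuous.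
Qed.

End AppellSum.

Lemma appell_ext_sums_axis (R : realType) n m (T : nat -> nat -> R) (b : nat -> R) (t : R) :
  n = m.*2.+1 -> appell_coefs n T -> forall K,
  cl_coord (appell_ext_sums T b (t *: delta_mx 0 ord0 : 'rV[R]_n.+1) K) finset.set0 =
  pseries b t K.
Proof.
move=> nE HT K; rewrite /appell_ext_sums /pseries /series/= cl_coord_sum.
apply: eq_bigr => k _; rewrite cl_coordZ (appell_poly_expand k _ nE HT).
rewrite pvec_axis big_nat_recl// big1 ?addr0 => [|j _]; last by rewrite exprS mul0r scaler0.
rewrite expr0 bin0 subn0 /appell_coef /appell_den big_ord0 fact0 divr1 !mul1r.
by rewrite cl_coordZ cl_coord_basis eqxx mulr1 !mxE !eqxx mulr1.
Qed.

(** At the real point $\rho$ the scalar coordinate of the series is $\sum b_k\rho^k$, and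
    convergence bounds its terms. *)
Lemma entire_coef_of_axis_cvg (R : realType) n m (T : nat -> nat -> R) (b : nat -> R) :
  n = m.*2.+1 -> appell_coefs n T ->
  (forall x : 'rV[R]_n.+1, cvgn (appell_ext_sums T b x)) -> entire_coef b.
Proof.
move=> nE HT cv rho rho0.
have cp : cvgn (pseries b rho).
  have /cvg_ex[l Hl] := cv (rho *: delta_mx 0 ord0).
  apply/cvg_ex; exists (cl_coord l finset.set0).
  rewrite (_ : pseries b rho = fun K => cl_coord (appell_ext_sums T b
     (rho *: delta_mx 0 ord0 : 'rV[R]_n.+1) K) finset.set0); last first.
    by apply/funext => K; rewrite (appell_ext_sums_axis b rho nE HT).
  apply: (@cvg_comp _ _ _ _ (fun y : clifford R n => cl_coord y finset.set0) _ (nbhs l)).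
    exact: Hl.
  exact: coord_continuous.
have [K [Kreal Kf]] := cvg_series_bounded cp.
exists (K + 1) => k; have := Kf (K + 1); rewrite ltrDl ltr01 => /(_ isT k I).
by rewrite /= normrM normrX (ger0_norm rho0).
Qed.

(** The quantity $k!\,|a_k|$ is multiplied by $|\gamma|$ at each jump of length $p$, so it is at
    most $CG^k$. Taking $G=1+|\gamma|\ge1$ allows one factor $G$ to be weakened to $G^p$. The terms
    of the exponential series at $G\rho$ then bound $|a_k|\rho^k$. *)
Lemma entire_coef_recurrence (R : realType) (a : nat -> R) (gamma : R) (p : nat) :
  (0 < p)%N ->
  (forall k, a (k + p)%N = gamma * k`!%:R / (k + p)`!%:R * a k) -> entire_coef a.
Proof.
move=> p0 rec rho rho0.
have f0 k : (k`!%:R : R) != 0 by rewrite pnatr_eq0 -lt0n fact_gt0.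
pose G := 1 + `|gamma|; have G1 : 1 <= G by rewrite lerDl.
have G0 : 0 <= G by exact: le_trans G1.
pose C := \sum_(0 <= k < p) k`!%:R * `|a k|.
have C0 : 0 <= C by apply: sumr_ge0 => k _; rewrite mulr_ge0.
have bound k : k`!%:R * `|a k| <= C * G ^+ k.
  elim/ltn_ind: k => k IH; have [kp|pk] := ltnP k p.
    apply: (@le_trans _ _ C); last by rewrite ler_peMr// exprn_ege1.
    rewrite /C big_mkord (bigD1 (Ordinal kp))//= lerDl sumr_ge0//.
  have kE : k = (k - p + p)%N by rewrite subnK.
  have lt : (k - p < k)%N by rewrite -{2}(subnK pk) -[X in (X < _)%N]addn0 ltn_add2l.
  have := IH _ lt; set j := (k - p)%N in kE lt * => IHj; rewrite kE rec.
  rewrite !normrM normfV !normr_nat.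
  rewrite [leLHS](_ : _ = `|gamma| * (j`!%:R * `|a j|)); last by field.
  apply: (@le_trans _ _ (G * (C * G ^+ j))).
    by rewrite ler_pM ?mulr_ge0// lerDr.
  rewrite mulrCA ler_wpM2l// -exprS ler_weXn2l//.
  by rewrite -addn1 leq_add2l.
have [K [Kreal Kf]] := cvg_series_bounded (is_cvg_series_exp_coeff (G * rho)).
exists (C * (K + 1)) => k; have := Kf (K + 1); rewrite ltrDl ltr01 => /(_ isT k I).
rewrite /= /exp_coeff [X in X <= _ -> _]ger0_norm ?divr_ge0 ?exprn_ge0 ?mulr_ge0// => H.
apply: le_trans (ler_wpM2l C0 H).
rewrite /= exprMn [leRHS](_ : _ = C * G ^+ k * rho ^+ k / k`!%:R); last by rewrite !mulrA.
rewrite ler_pdivlMr ?ltr0n ?fact_gt0//.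
rewrite [leLHS](_ : _ = k`!%:R * `|a k| * rho ^+ k); last by ring.
by rewrite ler_wpM2r ?exprn_ge0.
Qed.

Theorem theorem2 (R : realType) (f : R[i] -> R[i]) (a : nat -> R)
    (f_entire : entire f) (f_taylor : taylor_at0 f a)
    (n : nat) (n_odd : odd n) (n_gt1 : (1 < n)%N)
    (T : nat -> nat -> R) (T_appell : appell_coefs n T) :
  (exists alpha : R, forall x : 'rV[R]_n.+1,
     appell_ext_sums T a x @ \oo --> fueter_sce f alpha x)
  <->
  (exists2 gamma : R, gamma != 0 & forall k : nat,
     a (k + n - 1)%N = gamma * k`!%:R / (k + n - 1)`!%:R * a k).
Proof.
pose m := n./2.
have nE : n = m.*2.+1 by rewrite -[LHS]odd_double_half n_odd.
have m0 : (0 < m.*2)%N by rewrite -ltnS -nE.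
have idx k : (k + n - 1 = k + m.*2)%N by rewrite nE addnS subn1.
have f0 k : (k`!%:R : R) != 0 by rewrite pnatr_eq0 -lt0n fact_gt0.
have kap0 := fueter_const_neq0 R m.
split=> [[alpha H]|[gamma g0 rec]].
- have ea : entire_coef a.
    apply: (entire_coef_of_axis_cvg nE T_appell) => x; apply/cvg_ex.
    by eexists; exact: H.
  have fE := entire_eq_cseries f_entire f_taylor ea.
  have ed := entire_deriv2_coef m ea.
  pose c := alpha * fueter_const R m.
  have key k : a k - c * deriv2_coef m a k = 0.
    have ecd : entire_coef (fun k => c * deriv2_coef m a k).
      by apply: (@entire_coef_bounded_mul _ _ _ `|c|).
    have eD : entire_coef (fun k => a k - c * deriv2_coef m a k).
      move=> rho rho0; have [C1 H1] := ea _ rho0; have [C2 H2] := ecd _ rho0.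
      exists (C1 + C2) => j; apply: le_trans (lerD (H1 j) (H2 j)).
      by rewrite -mulrDl ler_wpM2r ?exprn_ge0// ler_normB.
    move: k; apply: (pseries_eq0 eD) => t.
    pose x : 'rV[R]_n.+1 := t *: delta_mx 0 ord0.
    have x0 : pvec x = 0 by exact: pvec_axis.
    have xt : x 0 ord0 = t by rewrite !mxE !eqxx mulr1.
    have : fueter_sce f alpha x = appell_sum m a x.
      apply: (cvg_unique (@norm_hausdorff _ _) (H x)).
      exact: (@appell_ext_sums_cvg R n m nE T a x T_appell ea).
    rewrite (fueter_sce_eq nE alpha x ea fE) !appell_sum_axis// xt.
    rewrite scalerA => /eqP; rewrite -subr_eq0 -scalerBl scaler_eq0 oner_eq0 orbF subr_eq0.
    rewrite -/c -limn_pseriesZ// => /eqP E.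
    rewrite (_ : pseries _ t = pseries a t - pseries (fun k => c * deriv2_coef m a k) t).
      rewrite limB; [by rewrite E subrr| |]; exact: entire_coef_pseries_cvg.
    apply/funext => K; rewrite /pseries /series !fctE -sumrB/=.
    by apply: eq_bigr => j _; exact: mulrBl.
  (* When $c=0$, [key] makes every $a_k$ vanish and the recurrence holds with $\gamma=1$; otherwise
     $\gamma=1/c$. *)
  have [c0|cn0] := eqVneq c 0.
    have a0 k : a k = 0 by have := key k; rewrite c0 mul0r subr0.
    by exists 1 => [|k]; rewrite ?oner_eq0// !a0 mulr0.
  exists c^-1 => [|k]; first by rewrite invr_eq0.
  have /eqP := key k; rewrite subr_eq0 idx => /eqP ->; rewrite /deriv2_coef.
  by field; rewrite cn0 !f0.
- have {}rec k : a (k + m.*2)%N = gamma * k`!%:R / (k + m.*2)`!%:R * a k.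
    by rewrite -idx.
  have ea := entire_coef_recurrence m0 rec.
  have fE := entire_eq_cseries f_entire f_taylor ea.
  (* In terms of functions the recurrence says $f^{(n-1)}=\gamma f$, which dictates
     $\alpha=1/(\gamma\kappa)$. *)
  have dE : deriv2_coef m a = (fun k => gamma * a k).
    by apply/funext => k; rewrite /deriv2_coef rec; field; rewrite !f0.
  exists (gamma * fueter_const R m)^-1 => x.
  rewrite (fueter_sce_eq nE _ x ea fE) invfM mulfVK//.
  have c1 := @appell_ext_sums_cvg R n m nE T a x T_appell ea.
  have c2 := @appell_ext_sums_cvg R n m nE T _ x T_appell (entire_deriv2_coef m ea).
  have c3 : appell_ext_sums T (deriv2_coef m a) x @ \oo --> gamma *: appell_sum m a x.
    rewrite (_ : appell_ext_sums _ _ _ = gamma \*: appell_ext_sums T a x).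
      exact: (@cvgZl_tmp _ _ _ _ _ gamma _ _ c1).
    apply/funext => K; rewrite /appell_ext_sums /series/= scaler_sumr.
    by apply: eq_bigr => k _; rewrite dE scalerA.
  rewrite (cvg_unique (@norm_hausdorff _ _) c2 c3).
  by rewrite scalerA (mulVf g0) scale1r.
Qed.
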